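(* Let $n \ge 1$ and let $T$ be a bounded linear operator on $H^2(\mathbb{D}^n)$. Then $T$ is a Toeplitz operator if and only if $T_{z_j}^{*} T T_{z_j} = T$ for all $j = 1, \ldots, n$.
   Context: $\mathbb{D}^n$ is the open unit polydisc in $\mathbb{C}^n$ and $\mathbb{T}^n$ is its distinguished boundary (the $n$-torus), with normalized Lebesgue measure. $H^2(\mathbb{D}^n)$ is the Hardy space of holomorphic functions $f$ on $\mathbb{D}^n$ with $\|f\|^2 = \sup_{0 \le r < 1} \int_{\mathbb{T}^n} |f(re^{i\theta_1}, \ldots, re^{i\theta_n})|^2 \, d\boldsymbol{\theta} < \infty$. Via radial limits it is identified with the closed subspace of $L^2(\mathbb{T}^n)$ consisting of functions whose Fourier coefficients $a_{\boldsymbol{k}}$, $\boldsymbol{k} \in \mathbb{Z}^n$, vanish whenever some $k_j < 0$. $T_{z_j}$ is the operator on $H^2(\mathbb{D}^n)$ of multiplication by the coordinate function $z_j$. $P_{H^2(\mathbb{D}^n)}$ is the orthogonal projection of $L^2(\mathbb{T}^n)$ onto $H^2(\mathbb{D}^n)$. For $\varphi \in L^\infty(\mathbb{T}^n)$, $M_\varphi$ is the operator $g \mapsto \varphi g$ on $L^2(\mathbb{T}^n)$. A bounded operator $T$ on $H^2(\mathbb{D}^n)$ is a Toeplitz operator if $T = P_{H^2(\mathbb{D}^n)} M_\varphi|_{H^2(\mathbb{D}^n)}$ for some $\varphi \in L^\infty(\mathbb{T}^n)$. *)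

(* Defs.v *)
From HB Require Import structures.
From mathcomp Require Import all_boot all_order all_algebra.
From mathcomp Require Import complex.
From mathcomp Require Import all_classical all_reals all_analysis.
From mathcomp Require Import measurable_realfun ess_sup_inf.

Set Implicit Arguments.
Unset Strict Implicit.
Unset Printing Implicit Defensive.

Import Order.TTheory GRing.Theory Num.Theory.
Import numFieldNormedType.Exports.
Import ComplexField.

Local Open Scope classical_set_scope.
Local Open Scope complex_scope.
Local Open Scope ring_scope.

Local Notation Re := complex.Re.
Local Notation Im := complex.Im.

Fact complex_display : measure_display. Proof. exact: default_measure_display. Qed.

(* The Borel sigma-algebra of R[i], seen as R * R. *)
Section complex_measurable.
Context {R : realType}.

Definition complex_pair (z : R[i]) : R * R :=
  (Re z, Im z).

HB.instance Definition _ := isPointed.Build R[i] 0.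

Let measC := preimage_set_system setT complex_pair measurable.

Let measC_sigma : sigma_algebra setT measC.
Proof. exact/sigma_algebra_preimage/sigma_algebra_measurable. Qed.

Let measC0 : measC set0. Proof. by case: measC_sigma. Qed.

Let measCC A : measC A -> measC (~` A).
Proof. by case: measC_sigma => _ + _ mA => /(_ _ mA); rewrite setTD. Qed.

Let measC_bigcup (F : (set R[i])^nat) :
  (forall i, measC (F i)) -> measC (\bigcup_i F i).
Proof. by case: measC_sigma => _ _; exact. Qed.

HB.instance Definition _ :=
  @isMeasurable.Build complex_display R[i] measC measC0 measCC measC_bigcup.

Lemma measurable_complexP d (T : measurableType d) (f : T -> R[i]) :
  measurable_fun setT f <->
  measurable_fun setT (fun x => Re (f x)) /\
  measurable_fun setT (fun x => Im (f x)).
Proof.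
rewrite -[X in _ <-> X](measurable_fun_pairP (complex_pair \o f)).
split=> mf _ A mA.
  have := mf measurableT (complex_pair @^-1` A); apply.
  by exists A => //; rewrite setTI.
by case: mA => B mB <-; rewrite setTI; exact: mf.
Qed.

End complex_measurable.

Section complex_measurable_ops.
Context {R : realType} d (T : measurableType d).
Implicit Types f g : T -> R[i].

Lemma measurable_cplxD f g : measurable_fun setT f -> measurable_fun setT g ->
  measurable_fun setT (fun x => f x + g x).
Proof.
move=> /measurable_complexP[fr fi] /measurable_complexP[gr gi].
apply/measurable_complexP; split.
  by under eq_fun do rewrite raddfD; exact: measurable_funD.
by under eq_fun do rewrite raddfD; exact: measurable_funD.
Qed.

Lemma measurable_cplxM f g : measurable_fun setT f -> measurable_fun setT g ->
  measurable_fun setT (fun x => f x * g x).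
Proof.
move=> /measurable_complexP[fr fi] /measurable_complexP[gr gi].
apply/measurable_complexP; split.
  rewrite (_ : (fun _ => _) =
      (fun x => Re (f x) * Re (g x)) \- (fun x => Im (f x) * Im (g x))).
    by apply: measurable_funB; exact: measurable_funM.
  by apply/funext => x /=; case: (f x) (g x) => [a b] [c e].
rewrite (_ : (fun _ => _) =
    (fun x => Re (f x) * Im (g x)) \+ (fun x => Im (f x) * Re (g x))).
  by apply: measurable_funD; exact: measurable_funM.
by apply/funext => x /=; case: (f x) (g x) => [a b] [c e].
Qed.

Lemma measurable_normc f : measurable_fun setT f ->
  measurable_fun setT (fun x => Normc.normc (f x)).
Proof.
move=> /measurable_complexP[fr fi].
rewrite (_ : (fun _ => _) =
    (@Num.sqrt R) \o (fun x => Re (f x) ^+ 2 + Im (f x) ^+ 2)).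
  apply: measurableT_comp.
    by apply: continuous_measurable_fun; exact: sqrt_continuous.
  by apply: measurable_funD; exact: measurable_funX.
by apply/funext => x /=; case: (f x).
Qed.

End complex_measurable_ops.

(* The unit circle, with the trace sigma-algebra and its normalized arc-length
   measure, i.e. the law of exp(i theta) for theta uniform on [0, 2 pi]. *)
Section circle.
Context {R : realType}.

Definition circle : Type := {z : R[i] | Normc.normc z == 1}.

HB.instance Definition _ := Choice.on circle.

Definition circle1 : circle := exist _ 1 (introT eqP (Normc.normc1 R)).

HB.instance Definition _ := isPointed.Build circle circle1.

Definition circle_val (z : circle) : R[i] := \val z.

Let measS := preimage_set_system setT circle_val measurable.

Let measS_sigma : sigma_algebra setT measS.
Proof. exact/sigma_algebra_preimage/sigma_algebra_measurable. Qed.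

Let measS0 : measS set0. Proof. by case: measS_sigma. Qed.

Let measSC A : measS A -> measS (~` A).
Proof. by case: measS_sigma => _ + _ mA => /(_ _ mA); rewrite setTD. Qed.

Let measS_bigcup (F : (set circle)^nat) :
  (forall i, measS (F i)) -> measS (\bigcup_i F i).
Proof. by case: measS_sigma => _ _; exact. Qed.

HB.instance Definition _ :=
  @isMeasurable.Build complex_display circle measS measS0 measSC measS_bigcup.

Lemma measurable_circle_val : measurable_fun setT circle_val.
Proof. by move=> _ A mA; exists A. Qed.

Fact cis_subproof (t : R) : Normc.normc (cos t +i* sin t) == 1.
Proof. by rewrite /= cos2Dsin2 sqrtr1. Qed.

Definition cis (t : measurableTypeR R) : circle := exist _ (cos t +i* sin t) (cis_subproof t).

Fact measurable_cis : measurable_fun [set: measurableTypeR R] cis.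
Proof.
move=> _ _ [A mA <-]; rewrite !setTI.
have : measurable_fun setT (fun t : R => cos t +i* sin t).
  apply/measurable_complexP; split=> /=; apply: continuous_measurable_fun.
    exact: continuous_cos.
  exact: continuous_sin.
by move=> /(_ measurableT _ mA); rewrite setTI.
Qed.

HB.instance Definition _ := isMeasurableFun.Build _ _ _ _ cis measurable_cis.

Fact twopi_gt0 : 0 < 2 * pi :> R.
Proof. by rewrite mulr_gt0 ?pi_gt0. Qed.

Definition arc_length : probability circle R :=
  distribution (uniform_prob twopi_gt0) cis.

End circle.
Arguments circle : clear implicits.

Section torus.
Context {R : realType}.

Definition torus n := n.-tuple (circle R).

Definition torus_cons n (p : circle R * torus n) : torus n.+1 :=
  [tuple of p.1 :: p.2].

Fact measurable_torus_cons n : measurable_fun setT (@torus_cons n).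
Proof. by apply: measurable_cons; [exact: measurable_fst|exact: measurable_snd]. Qed.

HB.instance Definition _ n :=
  isMeasurableFun.Build _ _ _ _ (@torus_cons n) (@measurable_torus_cons n).

Fixpoint haar n : probability (torus n) R :=
  if n is n'.+1 then distribution (arc_length \x haar n')%E (@torus_cons n')
  else dirac (@nil_tuple (circle R) : torus 0).

End torus.
Arguments torus : clear implicits.

Lemma filterS4 (T : Type) (F : set_system T) : Filter F ->
  forall P Q R S U : set T, (forall x, P x -> Q x -> R x -> S x -> U x) ->
  F P -> F Q -> F R -> F S -> F U.
Proof.
move=> FF P Q R S U h FP FQ FR FS.
by apply: filterS2 (filterI FP FQ) (filterI FR FS) => x [? ?] [? ?]; exact: h.
Qed.

Section cL0.
Context {R : realType} d (T : measurableType d) (P : probability T R).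

Definition cL0 : Type := {mfun_ P, T >-> R[i]}.

HB.instance Definition _ := Choice.on cL0.

Definition cL0_fun (f : cL0) : T -> R[i] := aqEqMfun_to_fun f.
Local Coercion cL0_fun : cL0 >-> Funclass.

Lemma measurable_cL0 (f : cL0) : measurable_fun setT f.
Proof. exact: measurable_funPT. Qed.

Definition cclass (f : T -> R[i]) (mf : measurable_fun setT f) : cL0 :=
  (\pi_({mfun_ P, T >-> R[i]}) (mfun_Sub (mem_set mf)))%qT.

Lemma cclassE f (mf : measurable_fun setT f) : ae_eq P setT (cclass mf) f.
Proof.
suff /asboolP : ae_eq_op P (repr (cclass mf)) (mfun_Sub (mem_set mf)) by [].
by rewrite -eqmodE /cclass reprK.
Qed.

Lemma cL0P (f g : cL0) : f = g <-> ae_eq P setT f g.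
Proof.
split=> [->|fg]; first exact: ae_eq_refl.
have : (repr f == repr g %[mod {mfun_ P, T >-> R[i]}])%qT.
  by rewrite eqmodE; exact/asboolP.
by rewrite !reprK => /eqP.
Qed.

Definition cL0_add (f g : cL0) : cL0 :=
  cclass (measurable_cplxD (measurable_cL0 f) (measurable_cL0 g)).

Definition cL0_mul (f g : cL0) : cL0 :=
  cclass (measurable_cplxM (measurable_cL0 f) (measurable_cL0 g)).

Definition cL0_scale (a : R[i]) (f : cL0) : cL0 :=
  cclass (measurable_cplxM (@measurable_cst _ _ T _ setT a) (measurable_cL0 f)).

Definition cL0_zero : cL0 := cclass (@measurable_cst _ _ T R[i] setT 0).

Definition cL0_opp (f : cL0) : cL0 := cL0_scale (-1) f.

Lemma cL0_addE f g : ae_eq P setT (cL0_add f g) (fun x => f x + g x).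
Proof. exact: cclassE. Qed.

Lemma cL0_mulE f g : ae_eq P setT (cL0_mul f g) (fun x => f x * g x).
Proof. exact: cclassE. Qed.

Lemma cL0_scaleE a f : ae_eq P setT (cL0_scale a f) (fun x => a * f x).
Proof. exact: cclassE. Qed.

Lemma cL0_zeroE : ae_eq P setT cL0_zero (fun=> 0).
Proof. exact: cclassE. Qed.

Fact cL0_addA : associative cL0_add.
Proof.
move=> f g h; apply/cL0P.
move: (cL0_addE f (cL0_add g h)) (cL0_addE g h)
  (cL0_addE (cL0_add f g) h) (cL0_addE f g).
by apply: filterS4 => x h1 h2 h3 h4 _; rewrite h1 ?h2 ?h3 ?h4 ?addrA.
Qed.

Fact cL0_addC : commutative cL0_add.
Proof.
move=> f g; apply/cL0P; move: (cL0_addE f g) (cL0_addE g f).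
by apply: filterS2 => x h1 h2 _; rewrite h1 ?h2 // addrC.
Qed.

Fact cL0_add0 : left_id cL0_zero cL0_add.
Proof.
move=> f; apply/cL0P; move: (cL0_addE cL0_zero f) cL0_zeroE.
by apply: filterS2 => x h1 h2 _; rewrite h1 ?h2 ?add0r.
Qed.

Fact cL0_addN : left_inverse cL0_zero cL0_opp cL0_add.
Proof.
move=> f; apply/cL0P; move: (cL0_addE (cL0_opp f) f) (cL0_scaleE (-1) f) cL0_zeroE.
by apply: filterS3 => x h1 h2 h3 _; rewrite h1 ?h2 ?h3 ?mulN1r ?addNr.
Qed.

HB.instance Definition _ :=
  GRing.isZmodule.Build cL0 cL0_addA cL0_addC cL0_add0 cL0_addN.

Fact cL0_scaleA a b f : cL0_scale a (cL0_scale b f) = cL0_scale (a * b) f.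
Proof.
apply/cL0P; move: (cL0_scaleE a (cL0_scale b f)) (cL0_scaleE b f)
  (cL0_scaleE (a * b) f).
by apply: filterS3 => x h1 h2 h3 _; rewrite h1 ?h2 ?h3 ?mulrA.
Qed.

Fact cL0_scale1 : left_id 1 cL0_scale.
Proof.
move=> f; apply/cL0P; move: (cL0_scaleE 1 f).
by apply: filterS => x h1 _; rewrite h1 ?mul1r.
Qed.

Fact cL0_scaleDr : right_distributive cL0_scale +%R.
Proof.
move=> a f g; apply/cL0P.
have fg : ae_eq P setT (cL0_scale a (f + g)) (fun x => a * (f x + g x)).
  move: (cL0_scaleE a (f + g)) (cL0_addE f g).
  by apply: filterS2 => x h1 h2 _; rewrite (h1 I) -(h2 I).
move: fg (cL0_addE (cL0_scale a f) (cL0_scale a g)) (cL0_scaleE a f)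
  (cL0_scaleE a g).
apply: filterS4 => x h1 h2 h3 h4 _.
by rewrite (h1 I) [RHS](h2 I) (h3 I) (h4 I) mulrDr.
Qed.

Fact cL0_scaleDl f : {morph cL0_scale^~ f : a b / a + b}.
Proof.
move=> a b; apply/cL0P.
move: (cL0_addE (cL0_scale a f) (cL0_scale b f)) (cL0_scaleE (a + b) f)
  (cL0_scaleE a f) (cL0_scaleE b f).
apply: filterS4 => x h1 h2 h3 h4 _.
by rewrite [RHS](h1 I) (h2 I) (h3 I) (h4 I) mulrDl.
Qed.

HB.instance Definition _ := GRing.Zmodule_isLmodule.Build R[i] cL0
  cL0_scaleA cL0_scale1 cL0_scaleDr cL0_scaleDl.

End cL0.

Section normc_facts.
Context {R : realType}.
Implicit Types z w : R[i].

Lemma normc_ge0 z : 0 <= Normc.normc z.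
Proof. by case: z => a b; exact: sqrtr_ge0. Qed.

Lemma ler_normcD z w :
  Normc.normc (z + w) <= Normc.normc z + Normc.normc w.
Proof. by rewrite -lecR rmorphD; exact: (ler_normD z w). Qed.

Lemma normcJ z : Normc.normc (conjc z) = Normc.normc z.
Proof. by case: z => a b /=; rewrite sqrrN. Qed.

Lemma normc_Re z : `|Re z| <= Normc.normc z.
Proof.
case: z => a b /=; rewrite -[`|a|]ger0_norm // -sqrtr_sqr ler_wsqrtr //.
by rewrite real_normK ?num_real // lerDl sqr_ge0.
Qed.

Lemma normc_Im z : `|Im z| <= Normc.normc z.
Proof.
case: z => a b /=; rewrite -[`|b|]ger0_norm // -sqrtr_sqr ler_wsqrtr //.
by rewrite real_normK ?num_real // lerDr sqr_ge0.
Qed.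

Lemma invc_unit z : Normc.normc z = 1 -> z^-1 = conjc z.
Proof.
move=> z1; have z0 : z != 0.
  by apply: contra_eq_neq z1 => ->; rewrite Normc.normc0 eq_sym oner_eq0.
apply: (mulfI z0); rewrite mulfV //; case: z z1 {z0} => a b /= z1.
have ab : a ^+ 2 + b ^+ 2 = 1.
  by rewrite -[LHS]sqr_sqrtr ?addr_ge0 ?sqr_ge0 // z1 expr1n.
apply/esym/eqP; rewrite eq_complex /=; apply/andP; split; apply/eqP.
  by rewrite mulrN opprK -!expr2.
by rewrite mulrN addrC mulrC subrr.
Qed.

End normc_facts.

Section complex_integral.
Context {R : realType} d (T : measurableType d) (P : probability T R).
Implicit Types f g : T -> R[i].

Definition cintegral f : R[i] :=
  (\int[P]_x Re (f x)) +i* (\int[P]_x Im (f x)).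

Definition cintegrable f : Prop :=
  P.-integrable setT (EFin \o (fun x => Re (f x))) /\
  P.-integrable setT (EFin \o (fun x => Im (f x))).

Lemma cintegralD f g : cintegrable f -> cintegrable g ->
  cintegral (fun x => f x + g x) = cintegral f + cintegral g.
Proof.
move=> [fr fi] [gr gi]; rewrite /cintegral; simpc.
rewrite -!RintegralD //; congr (_ +i* _); apply: eq_Rintegral => x _.
  by rewrite raddfD.
by rewrite raddfD.
Qed.

Lemma cintegralZ a f : cintegrable f ->
  cintegral (fun x => a * f x) = a * cintegral f.
Proof.
case: a => a b [fr fi]; rewrite /cintegral; simpc.
have Z (c : R) (h : T -> R) : P.-integrable setT (EFin \o h) ->
    P.-integrable setT (EFin \o (fun x => c * h x)).
  by move=> /(integrableZl measurableT c).
rewrite -!RintegralZl // -RintegralB ?Z // -RintegralD ?Z //.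
by congr (_ +i* _); apply: eq_Rintegral => x _; case: (f x).
Qed.

Lemma cintegrableZ a f : cintegrable f -> cintegrable (fun x => a * f x).
Proof.
case: a => a b [fr fi].
have Z (c : R) (h : T -> R) : P.-integrable setT (EFin \o h) ->
    P.-integrable setT (EFin \o (fun x => c * h x)).
  by move=> /(integrableZl measurableT c).
split.
  rewrite (_ : _ \o _ = (EFin \o (fun x => (a * Re (f x))%R)) \-
                        (EFin \o (fun x => (b * Im (f x))%R)))%E.
    by apply: integrableB => //; exact: Z.
  by apply/funext => x /=; case: (f x).
rewrite (_ : _ \o _ = (EFin \o (fun x => (a * Im (f x))%R)) \+
                      (EFin \o (fun x => (b * Re (f x))%R)))%E.
  by apply: integrableD => //; exact: Z.
by apply/funext => x /=; case: (f x).
Qed.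

Lemma ae_eq_cintegral f g : measurable_fun setT f -> measurable_fun setT g ->
  ae_eq P setT f g -> cintegral f = cintegral g.
Proof.
move=> /measurable_complexP[fr fi] /measurable_complexP[gr gi] fg.
congr (_ +i* _); congr fine; apply: ae_eq_integral => //;
  try exact/measurable_EFinP.
- by apply: filterS fg => x fg xT; rewrite fg.
- by apply: filterS fg => x fg xT; rewrite fg.
Qed.

End complex_integral.

Section cL2.
Context {R : realType} d (T : measurableType d) (P : probability T R).
Local Notation cL0 := (cL0 P).
Local Notation nrm f := (fun x => Normc.normc (cL0_fun f x)).
Implicit Types f g : cL0.

Definition in_cLp (p : \bar R) : {pred cL0} :=
  [pred f : cL0 | `[< finite_norm P p (nrm f) >]].

Lemma measurable_nrm f : measurable_fun setT (nrm f).
Proof. exact/measurable_normc/measurable_cL0. Qed.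

Lemma in_cL2E f : (f \in in_cLp 2%:E) = (nrm f \in Lfun P 2%:E).
Proof.
apply/idP/idP => [/asboolP h|].
  rewrite inE; apply/andP; split; rewrite inE; last exact: h.
  exact: measurable_nrm.
rewrite [in X in X -> _]inE => /andP[_]; rewrite inE => h.
by do 2 apply/asboolP.
Qed.

Lemma Lfun2_dom (f g : T -> R) : measurable_fun setT f -> g \in Lfun P 2%:E ->
  {ae P, forall x, `|f x| <= `|g x|} -> f \in Lfun P 2%:E.
Proof.
move=> mf g2 fg; rewrite inE; apply/andP; split; rewrite inE //=.
have /andP[/[!inE]/= mg] : (g \in mfun) && (g \in finLfun P 2%:E).
  by move: g2; rewrite inE.
rewrite /finite_norm; apply: le_lt_trans.
rewrite unlock; apply: gt0_ler_poweR => //.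
- by rewrite in_itv/= leey integral_ge0.
- by rewrite in_itv/= leey integral_ge0.
have mpow (h : T -> R) : measurable_fun setT h ->
    measurable_fun setT (fun x => (`|(EFin \o h) x| `^ 2)%E).
  move=> mh; apply/measurable_EFinP.
  apply/(@measurableT_comp _ _ _ _ _ _ (fun x : R => x `^ 2)) => //.
  exact/measurableT_comp.
apply: ae_ge0_le_integral => //; try exact: mpow.
- by move=> x _; exact: poweR_ge0.
- by move=> x _; exact: poweR_ge0.
by apply: filterS fg => x h _; rewrite lee_fin ge0_ler_powR ?nnegrE.
Qed.

Fact cL2_submod_closed : submod_closed (in_cLp 2%:E).
Proof.
have L0 : (fun=> 0) \in Lfun P 2%:E by exact: Lfun_cst.
split.
  rewrite in_cL2E; apply: Lfun2_dom L0 _; first exact: measurable_nrm.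
  apply: filterS (cL0_zeroE P) => x h.
  by rewrite [X in Normc.normc X](h I) Normc.normc0.
move=> a f g; rewrite !in_cL2E => f2 g2.
have h2 : (Normc.normc a \o* nrm f) \+ nrm g \in Lfun P 2%:E.
  apply: rpredD => //; first by rewrite lee1n.
  by move=> p1; apply: Lfun_scale => //; rewrite ler1n.
apply: Lfun2_dom h2 _; first exact: measurable_nrm.
move: (cL0_addE (a *: f) g) (cL0_scaleE a f); apply: filterS2 => x h1 h2.
rewrite [X in Normc.normc X](h1 I) (h2 I) /= !ger0_norm ?normc_ge0 //.
  by rewrite (le_trans (ler_normcD _ _)) // Normc.normcM mulrC.
by rewrite addr_ge0 ?mulr_ge0 ?normc_ge0.
Qed.

HB.instance Definition _ :=
  GRing.isSubmodClosed.Build R[i] cL0 (in_cLp 2%:E) cL2_submod_closed.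

Definition cL2 : Type := {f : cL0 | f \in in_cLp 2%:E}.

HB.instance Definition _ := SubType.on cL2.
HB.instance Definition _ := [Choice of cL2 by <:].
HB.instance Definition _ := [SubChoice_isSubLmodule of cL2 by <:].

Definition cLoo : Type := {f : cL0 | f \in in_cLp +oo%E}.

Definition cL2_fun (f : cL2) : T -> R[i] := cL0_fun (val f).
Local Coercion cL2_fun : cL2 >-> Funclass.

Definition cL2_norm (f : cL2) : R := fine 'N[P]_2%:E[EFin \o nrm (val f)].

Definition cdot (f g : cL2) : R[i] := cintegral P (fun x => f x * conjc (g x)).

Lemma cLoo_bounded (phi : cLoo) :
  exists M : R, {ae P, forall x, Normc.normc (cL0_fun (val phi) x) <= M}.
Proof.
case: phi => phi /= phiP.
have phi_fin : finite_norm P +oo%E (nrm phi) by apply/asboolP; exact: phiP.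
move: phi_fin; rewrite /finite_norm unlock /= probability_setT lte01 => phi_fin.
have /= := @ess_sup_ge _ _ _ P (abse \o (EFin \o nrm phi)).
move: phi_fin; case: (ess_sup _ _) => [M||] // _ h.
  exists M; apply: filterS h => x /=.
  by rewrite lee_fin ger0_norm ?normc_ge0.
by exists 0; apply: filterS h => x /=; rewrite leeNy_eq.
Qed.

Fact cmul_subproof (phi : cLoo) (g : cL2) :
  cL0_mul (val phi) (val g) \in in_cLp 2%:E.
Proof.
have [M phiM] := cLoo_bounded phi; case: g => g /= g2.
rewrite in_cL2E; move: (g2); rewrite in_cL2E => {}g2.
have h2 : `|M| \o* nrm g \in Lfun P 2%:E.
  by apply: Lfun_scale => //; rewrite ler1n.
apply: Lfun2_dom h2 _; first exact: measurable_nrm.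
move: phiM (cL0_mulE (val phi) g); apply: filterS2 => x phiM h1.
rewrite [X in Normc.normc X](h1 I) /= Normc.normcM !normrM normr_id mulrC.
rewrite ler_wpM2l // ger0_norm ?normc_ge0 //.
exact: le_trans phiM (ler_norm M).
Qed.

Definition cmul (phi : cLoo) (g : cL2) : cL2 :=
  Sub (cL0_mul (val phi) (val g)) (cmul_subproof phi g).

Lemma cmulE (phi : cLoo) (g : cL2) :
  ae_eq P setT (cmul phi g) (fun x => cL0_fun (val phi) x * g x).
Proof. exact: cL0_mulE. Qed.

End cL2.

Section hardy.
Context {R : realType} (n : nat).
Local Notation mu := (@haar R n).
Local Notation L2 := (cL2 mu).
Implicit Types (f g : L2) (k : 'I_n -> int) (z : torus R n).

Definition coordz (j : 'I_n) z : R[i] := circle_val (tnth z j).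

Definition zmono k z : R[i] := \prod_(i < n) coordz i z ^ k i.

Definition fourier f k : R[i] :=
  cintegral mu (fun z => cL2_fun f z * conjc (zmono k z)).

Lemma measurable_coordz j : measurable_fun setT (coordz j).
Proof.
apply: (measurableT_comp (@measurable_circle_val R)).
exact: measurable_tnth.
Qed.

Lemma normc_coordz j z : Normc.normc (coordz j z) = 1.
Proof. by rewrite /coordz /circle_val; case: (tnth z j) => w /= /eqP. Qed.

Lemma coordz_neq0 j z : coordz j z != 0.
Proof.
apply: contra_eq_neq (normc_coordz j z) => ->.
by rewrite Normc.normc0 eq_sym oner_eq0.
Qed.

Lemma normcX (w : R[i]) m : Normc.normc (w ^+ m) = Normc.normc w ^+ m.
Proof.
by elim: m => [|m IH]; rewrite ?expr0 ?Normc.normc1 // !exprS Normc.normcM IH.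
Qed.

Lemma normc_zmono k z : Normc.normc (zmono k z) = 1.
Proof.
rewrite /zmono; elim/big_rec: _ => [|i x _ x1]; first exact: Normc.normc1.
rewrite Normc.normcM x1 mulr1; case: (k i) => m.
  by rewrite -exprnP normcX normc_coordz expr1n.
by rewrite NegzE -exprnN Normc.normcV normcX normc_coordz expr1n invr1.
Qed.

Lemma measurable_conjc d (T : measurableType d) (f : T -> R[i]) :
  measurable_fun setT f -> measurable_fun setT (fun x => conjc (f x)).
Proof.
move=> /measurable_complexP[fr fi].
apply/(@measurable_complexP R _ _ (fun x => conjc (f x))); split.
  rewrite (_ : (fun _ => _) = (fun x => Re (f x))) //.
  by apply/funext => x; case: (f x).
rewrite (_ : (fun _ => _) = \- (fun x => Im (f x))); first exact: measurable_funN.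
by apply/funext => x /=; case: (f x).
Qed.

Lemma measurable_zmono k : measurable_fun setT (zmono k).
Proof.
rewrite /zmono; elim: (index_enum 'I_n) => [|i s IH].
  by under eq_fun do [rewrite big_nil]; exact: measurable_cst.
under eq_fun do rewrite big_cons.
apply: measurable_cplxM IH.
have mX (w : torus R n -> R[i]) m : measurable_fun setT w ->
    measurable_fun setT (fun z => w z ^+ m).
  move=> mw; elim: m => [|m IH]; first by under eq_fun do [rewrite expr0]; exact: measurable_cst.
  by under eq_fun do [rewrite exprS]; exact: measurable_cplxM.
case: (k i) => m.
  by under eq_fun do [rewrite -exprnP]; exact: (mX _ m (measurable_coordz i)).
under eq_fun => z.
  rewrite NegzE -exprnN invc_unit; last by rewrite normcX normc_coordz expr1n.
  over.
exact: measurable_conjc (mX _ m.+1 (measurable_coordz i)).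
Qed.

Lemma measurable_fourier f k :
  measurable_fun setT (fun z => cL2_fun f z * conjc (zmono k z)).
Proof.
apply: measurable_cplxM; first exact: measurable_cL0.
exact: measurable_conjc (measurable_zmono k).
Qed.

Lemma fourier_integrable f k :
  cintegrable mu (fun z => cL2_fun f z * conjc (zmono k z)).
Proof.
have f2 : (fun z => Normc.normc (cL2_fun f z)) \in Lfun mu 2%:E.
  by rewrite -in_cL2E; exact: valP.
have fi : mu.-integrable setT (EFin \o (fun z => Normc.normc (cL2_fun f z))).
  apply/Lfun1_integrable; apply: Lfun_subset12 f2 => //.
  exact: fin_num_measure.
have /measurable_complexP[mr mi] := measurable_fourier f k.
have le z : Normc.normc (cL2_fun f z * conjc (zmono k z)) <= `|Normc.normc (cL2_fun f z)|.
  by rewrite Normc.normcM normcJ normc_zmono mulr1 ler_norm.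
split; apply: le_integrable fi => //; try exact/measurable_EFinP.
  by move=> z _; rewrite lee_fin (le_trans (normc_Re _)).
by move=> z _; rewrite lee_fin (le_trans (normc_Im _)).
Qed.

(* H^2(D^n), identified through radial limits with the functions of L^2(T^n)
   whose Fourier coefficients vanish off the cone of nonnegative indices. *)
Definition in_H2 : {pred L2} :=
  [pred f | `[< forall k, (exists j, k j < 0) -> fourier f k = 0 >]].

Lemma in_H2P f :
  reflect (forall k, (exists j, k j < 0) -> fourier f k = 0) (f \in in_H2).
Proof. exact: asboolP. Qed.

Fact H2_submod_closed : submod_closed in_H2.
Proof.
split.
  apply/in_H2P => k _; rewrite /fourier.
  rewrite (@ae_eq_cintegral _ _ _ _ _ (fun=> 0)) //; last 2 first.
  - exact: measurable_fourier.
  - move: (cL0_zeroE mu); apply: filterS => z h _.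
    by rewrite [X in X * _](h I) mul0r.
  by rewrite /cintegral /= /Rintegral !integral0.
move=> a f g /in_H2P f0 /in_H2P g0; apply/in_H2P => k kn.
rewrite /fourier (@ae_eq_cintegral _ _ _ _ _ (fun z =>
  a * (cL2_fun f z * conjc (zmono k z)) + cL2_fun g z * conjc (zmono k z))) //.
- rewrite cintegralD ?cintegralZ; try exact: fourier_integrable.
    by rewrite -/(fourier f k) -/(fourier g k) f0 // g0 // mulr0 addr0.
  exact/cintegrableZ/fourier_integrable.
- exact: measurable_fourier.
- apply: measurable_cplxD; last exact: measurable_fourier.
  by apply: measurable_cplxM => //; exact: measurable_fourier.
- move: (cL0_addE (val (a *: f)) (val g)) (cL0_scaleE a (val f)).
  apply: filterS2 => z h1 h2 _.
  by rewrite [X in X * _](h1 I) [X in (X + _) * _](h2 I) mulrDl -mulrA.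
Qed.

HB.instance Definition _ :=
  GRing.isSubmodClosed.Build R[i] L2 in_H2 H2_submod_closed.

Definition H2 : Type := {f : L2 | f \in in_H2}.

HB.instance Definition _ := SubType.on H2.
HB.instance Definition _ := [Choice of H2 by <:].
HB.instance Definition _ := [SubChoice_isSubLmodule of H2 by <:].

Fact coordz_Loo j : @cclass _ _ _ mu _ (measurable_coordz j) \in in_cLp +oo%E.
Proof.
apply/asboolP; rewrite /finite_norm unlock /= probability_setT lte01.
apply: (@le_lt_trans _ _ 1%E); last exact: ltry.
apply/ess_supP; apply: filterS (@cclassE _ _ _ mu _ (measurable_coordz j)) => z h.
by rewrite /= lee_fin [X in Normc.normc X](h I) normc_coordz normr1.
Qed.

Definition coord_Loo (j : 'I_n) : cLoo mu :=
  exist (fun u : cL0 mu => u \in in_cLp +oo%E) _ (coordz_Loo j).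

Lemma zmono_shift k j z :
  zmono k z = coordz j z * zmono (fun i => k i - (i == j)%:Z) z.
Proof.
rewrite /zmono (bigD1 j) //= [in RHS](bigD1 j) //= mulrA eqxx; congr (_ * _).
  by rewrite -{2}[coordz j z]expr1z -expfzDr ?coordz_neq0 // addrC subrK.
by apply: eq_bigr => i /negbTE ->; rewrite subr0.
Qed.

Fact shift_subproof (j : 'I_n) (f : H2) :
  cmul (coord_Loo j) (val f) \in in_H2.
Proof.
case: f => f /= /in_H2P f0; apply/in_H2P => k [i ki].
rewrite -(f0 (fun i => k i - (i == j)%:Z)); last first.
  by exists i; rewrite (le_lt_trans _ ki) // gerBl; case: eqP.
apply: ae_eq_cintegral; try exact: measurable_fourier.
move: (cmulE (coord_Loo j) f) (@cclassE _ _ _ mu _ (measurable_coordz j)).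
apply: filterS2 => z h1 h2 _; rewrite (h1 I) [X in X * _ * _](h2 I).
rewrite (zmono_shift k j) rmorphM /= -(invc_unit (normc_coordz j z)).
by rewrite mulrACA divff ?coordz_neq0 // mul1r.
Qed.

Definition Tz (j : 'I_n) (f : H2) : H2 :=
  exist (fun g : L2 => g \in in_H2) _ (shift_subproof j f).

(* xget 0 selects the unique element with the stated property; it exists
   because H^2 is closed in L^2. *)
Definition projH2 (g : L2) : H2 :=
  xget 0 [set h : H2 | forall u : H2, cdot (g - val h) (val u) = 0].

Definition bounded_op (A : H2 -> H2) : Prop :=
  exists C : R, forall f : H2, cL2_norm (val (A f)) <= C * cL2_norm (val f).

(* The Hilbert space adjoint; here xget 0 selects the unique representative of
   f |-> <A f, g>, which exists by Riesz when A is linear and bounded. *)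
Definition adjoint (A : H2 -> H2) (g : H2) : H2 :=
  xget 0 [set h : H2 | forall f : H2,
    cdot (val (A f)) (val g) = cdot (val f) (val h)].

Definition toeplitz (A : H2 -> H2) : Prop :=
  exists phi : cLoo mu, A = fun f : H2 => projH2 (cmul phi (val f)).

End hardy.
Arguments H2 : clear implicits.

(* Main.v *)
Require Import Defs.
From HB Require Import structures.
From mathcomp Require Import all_boot all_order all_algebra.
From mathcomp Require Import complex ring lra zify.
From mathcomp Require Import all_classical all_reals all_analysis.
From mathcomp Require Import measurable_realfun ess_sup_inf.

(** The condition [adjoint (Tz j) \o T \o Tz j = T] says that the sesquilinear
    form of [T] is unchanged when both arguments are multiplied by [z_j]
    ([adjoint_Tz_invariantP]). For the form [<phi u, v>] of a Toeplitz operator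
    this is clear, because the coordinates have modulus one
    ([toeplitz_form_invariant]).

    Conversely, let the form of [T] be invariant, let [C] bound [T], and write
    [z^m] for the [m]-th power of the product of all coordinates. The functions
    [phi_ m = z^-m T(z^m)] would be the truncations of the symbol. Invariance
    gives [<phi_ l, phi_ m> = <phi_ m, phi_ m>] for [m <= l], so the squared
    norm of [phi_ l - phi_ m] is the difference of the squared norms; these are
    bounded by the square of [C], hence [phi_] converges in [L^2] to some [phi]
    ([phi_cvg]), and [<phi p, v> = <T p, v>] for analytic polynomials [p]. For
    trigonometric polynomials [p] and [q], multiplying both by a high power of
    the coordinates leads back to the analytic case, whence
    [|<phi p, q>| <= C |p| |q|] ([cdot_mul_trig_phi_le]). Trigonometric
    polynomials are dense, so multiplication by [phi] cannot stretch an
    indicator by more than [C], and [phi] is bounded by [C] almost everywhere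
    ([phi_bound]). Analytic polynomials are dense in [H^2], so
    [<T u, v> = <phi u, v>] on all of [H^2] ([T_symbol]).

    The analysis behind this is the following. [L^2] is complete
    ([cL2_complete]), so orthogonal projections exist ([cL2_projection]); this
    makes [projH2] and the adjoints of the shifts meaningful, and reduces both
    density statements to the fact that a function without Fourier coefficients
    is zero ([fourier_eq0]). That fact is proved by a monotone class argument:
    the bounded functions that multiply the annihilator of the characters into
    itself form an algebra closed under bounded limits which contains the
    coordinates, hence the indicators of all measurable sets. *)

Set Implicit Arguments.
Unset Strict Implicit.
Unset Printing Implicit Defensive.

Import Order.TTheory GRing.Theory Num.Theory.
Import numFieldNormedType.Exports.
Import ComplexField.

Local Open Scope classical_set_scope.
Local Open Scope complex_scope.
Local Open Scope ring_scope.

Local Notation Re := complex.Re.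
Local Notation Im := complex.Im.
Local Notation normc := Normc.normc.

(** * The Hermitian form of [L^2] *)

Section complex_numbers.
Context {R : realType}.
Implicit Types (z w : R[i]) (x : R).

Lemma mulcJ z : z * conjc z = ((normc z) ^+ 2)%:C.
Proof.
case: z => a b; rewrite /= sqr_sqrtr ?addr_ge0 ?sqr_ge0 //; simpc.
by rewrite -!expr2 [b * a]mulrC addNr.
Qed.

Lemma normc_real x : 0 <= x -> normc x%:C = x.
Proof. by move=> x0 /=; rewrite expr0n addr0 sqrtr_sqr ger0_norm. Qed.

Lemma Re_mulJ z : Re (z * conjc z) = (normc z) ^+ 2.
Proof. by rewrite mulcJ. Qed.

Lemma Re_le_normc z : Re z <= normc z.
Proof. exact: le_trans (ler_norm _) (normc_Re z). Qed.

Lemma normc_eq0 z : normc z = 0 -> z = 0.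
Proof. exact: Normc.eq0_normc. Qed.

Lemma sqr_normc z : (normc z) ^+ 2 = (Re z) ^+ 2 + (Im z) ^+ 2.
Proof. by case: z => a b; rewrite /= sqr_sqrtr // addr_ge0 // sqr_ge0. Qed.

Lemma Re_scale x z : Re (x%:C * z) = x * Re z.
Proof. by case: z => a b /=; rewrite mul0r subr0. Qed.

Lemma Re_conj_scale x z : Re (conjc (x%:C * z) * z) = x * (normc z) ^+ 2.
Proof. by rewrite sqr_normc; case: z => a b /=; ring. Qed.

Lemma normcN z : normc (- z) = normc z.
Proof. by case: z => a b /=; rewrite !sqrrN. Qed.


End complex_numbers.

Section inner_product.
Context {R : realType} d (T : measurableType d) (P : probability T R).
Local Notation L2 := (cL2 P).
Implicit Types (f g h : L2) (a : R[i]).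

Lemma cL2P f g : f = g <-> ae_eq P setT (cL2_fun f) (cL2_fun g).
Proof.
split=> [->|fg]; first exact: ae_eq_refl.
by apply/val_inj/cL0P.
Qed.

Lemma cL2_funZD a f g :
  ae_eq P setT (cL2_fun (a *: f + g)) (fun x => a * cL2_fun f x + cL2_fun g x).
Proof.
move: (cL0_addE (val (a *: f)) (val g)) (cL0_scaleE a (val f)).
by apply: filterS2 => x h1 h2 _; rewrite -(h2 I) -(h1 I).
Qed.

Lemma measurable_cL2 f : measurable_fun setT (cL2_fun f).
Proof. exact: measurable_cL0. Qed.

Lemma cL2_Lfun f : (fun x => normc (cL2_fun f x)) \in Lfun P 2%:E.
Proof. by rewrite -in_cL2E; exact: valP. Qed.

Lemma measurable_mulJ f g :
  measurable_fun setT (fun x => cL2_fun f x * conjc (cL2_fun g x)).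
Proof.
apply: measurable_cplxM; first exact: measurable_cL2.
exact/measurable_conjc/measurable_cL2.
Qed.

Lemma cintegrable_dominated (F : T -> R[i]) (G : T -> R) :
  measurable_fun setT F -> P.-integrable setT (EFin \o G) ->
  (forall x, normc (F x) <= G x) -> cintegrable P F.
Proof.
move=> /measurable_complexP[mr mi] Gi FG.
split; apply: le_integrable Gi => //; try exact/measurable_EFinP.
  move=> x _; rewrite lee_fin (le_trans (normc_Re _)) //.
  exact: le_trans (FG x) (ler_norm _).
move=> x _; rewrite lee_fin (le_trans (normc_Im _)) //.
exact: le_trans (FG x) (ler_norm _).
Qed.

Lemma cintegrable_mulJ f g :
  cintegrable P (fun x => cL2_fun f x * conjc (cL2_fun g x)).
Proof.
apply: cintegrable_dominated (measurable_mulJ f g) _ _.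
  exact/Lfun1_integrable/(Lfun2_mul_Lfun1 (cL2_Lfun f) (cL2_Lfun g)).
by move=> x /=; rewrite Normc.normcM Defs.normcJ.
Qed.

Lemma cdotZDl a f g h : cdot (a *: f + g) h = a * cdot f h + cdot g h.
Proof.
rewrite /cdot (@ae_eq_cintegral _ _ _ _ _ (fun x =>
  a * (cL2_fun f x * conjc (cL2_fun h x)) + cL2_fun g x * conjc (cL2_fun h x))).
- rewrite cintegralD ?cintegralZ //; try exact: cintegrable_mulJ.
  exact/cintegrableZ/cintegrable_mulJ.
- exact: measurable_mulJ.
- apply: measurable_cplxD; last exact: measurable_mulJ.
  by apply: measurable_cplxM => //; exact: measurable_mulJ.
- move: (cL2_funZD a f g); apply: filterS => x h1 _.
  by rewrite (h1 I) mulrDl mulrA.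
Qed.

Lemma cdotC f g : cdot g f = conjc (cdot f g).
Proof.
rewrite /cdot /cintegral /=; congr (_ +i* _).
  apply: eq_Rintegral => x _.
  by case: (cL2_fun f x) (cL2_fun g x) => ? ? [? ?] /=; ring.
rewrite -[RHS]mulN1r -RintegralZl //; last by have [_] := cintegrable_mulJ f g.
apply: eq_Rintegral => x _.
by case: (cL2_fun f x) (cL2_fun g x) => ? ? [? ?] /=; ring.
Qed.

(** [cdot] with its linear argument last, so that the theory of linear maps
    applies to it. *)
Definition cdotl h f : R[i] := cdot f h.

Fact cdotl_linear h : linear (cdotl h).
Proof. by move=> a f g; exact: cdotZDl. Qed.

HB.instance Definition _ h :=
  GRing.isLinear.Build R[i] L2 R[i] _ (cdotl h) (cdotl_linear h).

Lemma cdotBl f g h : cdot (f - g) h = cdot f h - cdot g h.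
Proof. exact: (raddfB (cdotl h)). Qed.

Lemma cdot0l h : cdot 0 h = 0.
Proof. exact: (raddf0 (cdotl h)). Qed.

Lemma cdotZl a f h : cdot (a *: f) h = a * cdot f h.
Proof. exact: (linearZ_LR (cdotl h)). Qed.

Lemma cdot_suml I (r : seq I) (F : I -> L2) h :
  cdot (\sum_(i <- r) F i) h = \sum_(i <- r) cdot (F i) h.
Proof. exact: (raddf_sum (cdotl h)). Qed.

Lemma cdotBr f g h : cdot f (g - h) = cdot f g - cdot f h.
Proof. by rewrite [LHS]cdotC cdotBl rmorphB [cdot f g]cdotC [cdot f h]cdotC. Qed.

Lemma cdot0r f : cdot f 0 = 0.
Proof. by rewrite cdotC cdot0l rmorph0. Qed.

Lemma cdotZr a f g : cdot f (a *: g) = conjc a * cdot f g.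
Proof. by rewrite [LHS]cdotC cdotZl rmorphM [cdot f g]cdotC. Qed.

Local Notation N := (@cL2_norm R d T P).

Lemma sqr_cL2_norm f :
  (N f) ^+ 2 = \int[P]_x (normc (cL2_fun f x)) ^+ 2.
Proof.
rewrite /cL2_norm /Rintegral.
have -> : (\int[P]_x ((normc (cL2_fun f x)) ^+ 2)%:E)%E =
    ('N[P]_2%:E[EFin \o (fun x => normc (cL2_fun f x))] `^ 2)%E.
  rewrite poweR_Lnorm //; apply: eq_integral => x _ /=.
  by rewrite ger0_norm ?normc_ge0 // powR_mulrn // normc_ge0.
have := Lnorm_ge0 P 2%:E (EFin \o (fun x => normc (cL2_fun f x))).
rewrite /cL2_fun; case: (Lnorm _ _ _) => [r||] //= r0.
  by rewrite powR_mulrn.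
by rewrite expr0n pnatr_eq0.
Qed.

Lemma cL2_norm_ge0 f : 0 <= N f.
Proof. by rewrite fine_ge0 // Lnorm_ge0. Qed.

Lemma cdot_norm f : cdot f f = ((N f) ^+ 2)%:C.
Proof.
rewrite sqr_cL2_norm /cdot /cintegral; congr (_ +i* _).
  by apply: eq_Rintegral => x _; exact: Re_mulJ.
rewrite (_ : (fun x => _) = fun=> 0); first by rewrite /Rintegral integral0.
by apply/funext => x; rewrite mulcJ.
Qed.

Lemma sqr_cL2_normE f : (N f) ^+ 2 = Re (cdot f f).
Proof. by rewrite cdot_norm. Qed.

Lemma cL2_norm_eq0 f : N f = 0 -> f = 0.
Proof.
move=> f0.
have : ae_eq P setT (fun x => ((normc (cL2_fun f x)) ^+ 2)%:E) (cst 0%E).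
  apply/ae_eq_integral_abs => //.
    apply/measurable_EFinP/measurable_funX.
    exact/measurable_normc/measurable_cL2.
  under eq_integral => x _ do rewrite gee0_abs ?lee_fin ?sqr_ge0 //.
  have fi : P.-integrable setT (EFin \o (fun x => (normc (cL2_fun f x)) ^+ 2)).
    exact: Lfun2_integrable_sqr (cL2_Lfun f).
  rewrite -[LHS]fineK; last exact: integrable_fin_num.
  by move: (sqr_cL2_norm f); rewrite f0 expr0n /Rintegral /= => <-.
move=> h; apply/cL2P; move: h (cL0_zeroE P); apply: filterS2 => x h1 h2 _.
rewrite [RHS](h2 I); apply: normc_eq0.
by have [/eqP] := h1 I; rewrite sqrf_eq0 => /eqP.
Qed.

Lemma cL2_norm0 : N 0 = 0.
Proof. by apply/eqP; rewrite -sqrf_eq0 sqr_cL2_normE cdot0l. Qed.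

Lemma cL2_normZ a f : N (a *: f) = normc a * N f.
Proof.
apply: (pexpIrn (n := 2)); rewrite ?nnegrE ?mulr_ge0 ?cL2_norm_ge0 ?normc_ge0 //.
rewrite sqr_cL2_normE cdotZl cdotZr mulrA mulcJ cdot_norm Re_scale /=.
by rewrite exprMn.
Qed.

Lemma cL2_normN f : N (- f) = N f.
Proof. by rewrite -scaleN1r cL2_normZ normcN Normc.normc1 mul1r. Qed.

Lemma cL2_normBC f g : N (f - g) = N (g - f).
Proof. by rewrite -opprB cL2_normN. Qed.

Lemma sqr_cL2_normB f g :
  (N (f - g)) ^+ 2 = (N f) ^+ 2 - 2 * Re (cdot f g) + (N g) ^+ 2.
Proof.
rewrite !sqr_cL2_normE cdotBl !cdotBr [cdot g f]cdotC.
by case: (cdot f f) (cdot f g) (cdot g g) => [? ?] [? ?] [? ?] /=; ring.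
Qed.

(** The scalar is the one that minimizes the distance from [f] to the line
    through [g]. *)
Lemma sqr_cL2_normB_scale f g : N g != 0 ->
  (N (f - (((N g) ^- 2)%:C * cdot f g) *: g)) ^+ 2 =
  (N f) ^+ 2 - (normc (cdot f g)) ^+ 2 / (N g) ^+ 2.
Proof.
move=> g0; have n0 : (N g) ^+ 2 != 0 by rewrite sqrf_eq0.
rewrite sqr_cL2_normB cL2_normZ cdotZr Re_conj_scale Normc.normcM normc_real.
  by field.
by rewrite invr_ge0 sqr_ge0.
Qed.

Lemma cauchy_schwarz f g : normc (cdot f g) <= N f * N g.
Proof.
have [g0|g0] := eqVneq (N g) 0.
  by rewrite (cL2_norm_eq0 g0) cdot0r Normc.normc0 cL2_norm0 mulr0.
have gt0 : 0 < (N g) ^+ 2 by rewrite exprn_gt0 // lt_neqAle eq_sym g0 cL2_norm_ge0.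
rewrite -(@ler_pXn2r _ 2) ?nnegrE ?mulr_ge0 ?cL2_norm_ge0 ?normc_ge0 //.
rewrite exprMn -ler_pdivrMr // -subr_ge0 -sqr_cL2_normB_scale //.
exact: sqr_ge0.
Qed.

Lemma cL2_normD f g : N (f + g) <= N f + N g.
Proof.
rewrite -(@ler_pXn2r _ 2) ?nnegrE ?addr_ge0 ?cL2_norm_ge0 //.
have := sqr_cL2_normB f (- g); rewrite opprK => ->.
have -> : cdot f (- g) = - cdot f g by rewrite -scaleN1r cdotZr rmorphN1 mulN1r.
have := le_trans (Re_le_normc _) (cauchy_schwarz f g).
by rewrite raddfN /= cL2_normN => h; nra.
Qed.

Lemma cL2_dist_triangle f g h : N (f - h) <= N (f - g) + N (g - h).
Proof. by rewrite (le_trans _ (cL2_normD _ _)) // addrA subrK. Qed.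

End inner_product.

(** * Completeness of [L^2] *)

Section completeness.
Context {R : realType} d (T : measurableType d) (P : probability T R).
Local Notation L2 := (cL2 P).
Implicit Types (f g h : L2) (u : nat -> L2).
Local Notation N := (@cL2_norm R d T P).

Lemma finite_variation_cvg (v : nat -> R) :
  (\sum_(i <oo) `|v i.+1 - v i|%:E < +oo)%E -> cvgn v.
Proof.
set s := (X in (X < _)%E) => sfin.
have s0 : (0 <= s)%E by apply: nneseries_ge0.
have cvgS : cvgn (series (telescope v)).
  apply: normed_cvg; apply: nondecreasing_is_cvgn.
    by apply: nondecreasing_series => n _ _ /=.
  exists (fine s) => _ [k _ <-].
  rewrite -lee_fin fineK ?ge0_fin_numE // /series /= -sumEFin.
  exact: nneseries_lim_ge.
rewrite (_ : v = (fun k => v 0%N + series (telescope v) k)).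
  exact: is_cvgD (is_cvg_cst _) cvgS.
by apply/funext => k; exact: eq_sum_telescope.
Qed.

Lemma cL2_of_sqr_integrable (F : T -> R[i]) : measurable_fun setT F ->
  (\int[P]_x ((normc (F x)) ^+ 2)%:E < +oo)%E ->
  exists f : L2, ae_eq P setT (cL2_fun f) F.
Proof.
move=> mF Ffin.
have FE := @cclassE _ _ _ P F mF.
suff h : cclass P mF \in in_cLp 2%:E.
  by exists (exist (fun f : cL0 P => f \in in_cLp 2%:E) _ h).
rewrite in_cL2E.
have F2 : (fun x => normc (F x)) \in Lfun P 2%:E.
  rewrite inE; apply/andP; split; rewrite inE /=; first exact: measurable_normc.
  rewrite /finite_norm unlock; apply: poweR_lty.
  apply: le_lt_trans Ffin; rewrite le_eqVlt; apply/orP; left; apply/eqP.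
  apply: eq_integral => x _ /=.
  by rewrite ger0_norm ?normc_ge0 // powR_mulrn // normc_ge0.
apply: Lfun2_dom F2 _; first exact: measurable_nrm.
by apply: filterS FE => x h; rewrite [X in normc X](h I).
Qed.

Lemma integral_sqr_cL2 f :
  (\int[P]_x ((normc (cL2_fun f x)) ^+ 2)%:E)%E = ((N f) ^+ 2)%:E.
Proof.
rewrite sqr_cL2_norm /Rintegral fineK //.
exact: integrable_fin_num (Lfun2_integrable_sqr (cL2_Lfun f)).
Qed.

Lemma measurable_sqr_normc (F : T -> R[i]) : measurable_fun setT F ->
  measurable_fun setT (fun x => ((normc (F x)) ^+ 2)%:E).
Proof. by move=> mF; apply/measurable_EFinP/measurable_funX/measurable_normc. Qed.

Lemma probability_integral_cst (c : R) : (\int[P]_x c%:E = c%:E)%E.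
Proof.
rewrite (integral_cst P measurableT) -[RHS]mule1; congr (_ * _)%E.
exact: probability_setT.
Qed.

(** Young's inequality [2 a <= a ^+ 2 / e + e] under the integral: on a
    probability space the [L^1] norm is bounded by the [L^2] norm. *)
Lemma integral_normc_le f (e : R) : 0 < e -> N f <= e ->
  (\int[P]_x (normc (cL2_fun f x))%:E <= e%:E)%E.
Proof.
move=> e0 fe.
have mn := measurable_normc (measurable_cL2 f).
apply: (@le_trans _ _ (\int[P]_x ((2 * e)^-1%:E * ((normc (cL2_fun f x)) ^+ 2)%:E
   + (e / 2)%:E))%E).
  apply: ge0_le_integral => //.
  - by move=> x _; rewrite lee_fin normc_ge0.
  - exact/measurable_EFinP.
  - apply: emeasurable_funD => //; apply: emeasurable_funM => //.
    exact/measurable_sqr_normc/measurable_cL2.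
  move=> x _; rewrite -EFinM -EFinD lee_fin; set a := normc _.
  have : 0 <= (a - e) ^+ 2 / (2 * e) by rewrite divr_ge0 ?sqr_ge0 // mulr_ge0 // ltW.
  rewrite -subr_ge0; congr (_ <= _); field; exact: lt0r_neq0.
rewrite ge0_integralD //; first last.
- by move=> x _; rewrite lee_fin divr_ge0 // ltW.
- apply: emeasurable_funM => //; exact/measurable_sqr_normc/measurable_cL2.
- move=> x _; rewrite -EFinM lee_fin mulr_ge0 ?sqr_ge0 //.
  by rewrite invr_ge0 mulr_ge0 // ltW.
rewrite ge0_integralZl //; last 3 first.
- exact/measurable_sqr_normc/measurable_cL2.
- by move=> x _; rewrite lee_fin sqr_ge0.
- by rewrite lee_fin invr_ge0 mulr_ge0 // ltW.
rewrite integral_sqr_cL2 probability_integral_cst -EFinM -EFinD.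
rewrite lee_fin; have h : (N f) ^+ 2 <= e ^+ 2.
  by rewrite ler_pXn2r ?nnegrE // ?cL2_norm_ge0 // ltW.
rewrite -[leRHS](_ : (2 * e)^-1 * e ^+ 2 + e / 2 = e).
  by rewrite lerD2r ler_wpM2l // invr_ge0 mulr_ge0 // ltW.
by field; exact: lt0r_neq0.
Qed.

Lemma measurable_fun_limn_einf (F : nat -> T -> \bar R) :
  (forall n, measurable_fun setT (F n)) ->
  measurable_fun setT (fun x => limn_einf (F^~ x)).
Proof.
move=> mF.
rewrite (_ : (fun x => _) = fun x => (- limn_esup (fun n => - F n x))%E).
  apply: measurableT_comp => //.
  apply: (@measurable_fun_limn_esup _ _ _ _ (fun n x => - F n x)%E) => n.
  exact: measurableT_comp.
apply/funext => x; rewrite -limn_einfN; congr limn_einf.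
by apply/funext => n /=; rewrite oppeK.
Qed.

(** The increments of [u] have summable [L^1] norms, so they are summable almost
    everywhere and [u] converges almost everywhere. Fatou's lemma, applied to
    the squared distances between terms of [u], makes this a limit in norm. *)
Lemma riesz_fischer_fast u :
  (forall k l, (k <= l)%N -> N (u l - u k) <= 2^-1 ^+ k) ->
  exists f, forall k, N (u k - f) <= 2^-1 ^+ k.
Proof.
move=> u_fast.
pose e k : R := 2^-1 ^+ k.
have e0 k : 0 < e k by rewrite exprn_gt0 // invr_gt0.
pose d_ k := cL2_fun (u k.+1 - u k).
have mu_ k := measurable_cL2 (u k).
have mnd k : measurable_fun setT (fun x => (normc (d_ k x))%:E).
  by apply/measurable_EFinP/measurable_normc; exact: measurable_cL2.
have d_sum : (\int[P]_x (\sum_(k <oo) (normc (d_ k x))%:E) < +oo)%E.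
  rewrite integral_nneseries //; last by move=> k x _; rewrite lee_fin normc_ge0.
  apply: (@le_lt_trans _ _ (\sum_(k <oo) (e k)%:E)%E).
    apply: lee_nneseries => [k _ _|k _].
      by apply: integral_ge0 => x _; rewrite lee_fin normc_ge0.
    exact: integral_normc_le (e0 k) (u_fast _ _ (leqnSn k)).
  rewrite (@eq_eseriesr _ _ (fun k => (2 / (2 ^ (k + 1))%:R)%:E)).
    by rewrite (cvg_lim _ (@cvg_geometric_eseries_half R 2 0)) ?ltry.
  move=> k _; rewrite /e exprVn addn1 expnS natrM natrX; congr (_%:E).
  by rewrite invfM mulrA divff ?pnatr_eq0 // mul1r.
have d_ae : {ae P, forall x, (\sum_(k <oo) (normc (d_ k x))%:E < +oo)%E}.
  have : P.-integrable setT (fun x => \sum_(k <oo) (normc (d_ k x))%:E)%E.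
    apply/integrableP; split.
      apply: ge0_emeasurable_sum => //.
      by move=> k x _ _; rewrite lee_fin normc_ge0.
    apply: le_lt_trans d_sum; rewrite le_eqVlt; apply/orP; left; apply/eqP.
    apply: eq_integral => x _; rewrite gee0_abs //.
    by apply: nneseries_ge0 => k _ _; rewrite lee_fin normc_ge0.
  move=> /(integrable_ae measurableT); apply: filterS => x /(_ I).
  rewrite ge0_fin_numE //.
  by apply: nneseries_ge0 => k _ _; rewrite lee_fin normc_ge0.
have dE : {ae P, forall x, forall k, d_ k x = cL2_fun (u k.+1) x - cL2_fun (u k) x}.
  apply/ae_foralln => k.
  move: (cL2_funZD (-1) (u k) (u k.+1)); apply: filterS => x h.
  by rewrite /d_ addrC -scaleN1r (h I) mulN1r addrC.
(* The upper limit is measurable in [x] even where the sequence diverges. *)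
pose lim_re x := fine (limn_esup (fun k => (Re (cL2_fun (u k) x))%:E)).
pose lim_im x := fine (limn_esup (fun k => (Im (cL2_fun (u k) x))%:E)).
pose F x : R[i] := lim_re x +i* lim_im x.
have mF : measurable_fun setT F.
  have mlim (v : nat -> T -> R) : (forall k, measurable_fun setT (v k)) ->
      measurable_fun setT (fun x => fine (limn_esup (fun k => (v k x)%:E))).
    move=> mv; apply: measurableT_comp => //.
    apply: (@measurable_fun_limn_esup _ _ _ _ (fun k x => (v k x)%:E)) => k.
    exact/measurable_EFinP.
  apply/measurable_complexP; split=> /=; apply: mlim => k;
    by have /measurable_complexP[] := mu_ k.
have uF : {ae P, forall x,
    (Re (cL2_fun (u k) x) @[k --> \oo] --> Re (F x)) /\
    (Im (cL2_fun (u k) x) @[k --> \oo] --> Im (F x))}.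
  move: d_ae dE; apply: filterS2 => x dx dxE.
  have cvgE (v : nat -> R) : (forall k, `|v k.+1 - v k| <= normc (d_ k x)) ->
      v k @[k --> \oo] --> fine (limn_esup (fun k => (v k)%:E)).
    move=> vd; have cv : cvgn v.
      apply: finite_variation_cvg; apply: le_lt_trans dx.
      by apply: lee_nneseries => [k _ _|k _]; rewrite lee_fin.
    have cve : cvgn (EFin \o v).
      apply/cvg_ex; exists (limn v)%:E; apply/fine_cvgP.
      by split => //; exact: nearW.
    rewrite is_cvg_limn_esupE // EFin_lim //.
  split; apply: cvgE => k; rewrite -raddfB /= -dxE; [exact: normc_Re | exact: normc_Im].
have uk_le k :
    (\int[P]_x ((normc (cL2_fun (u k) x - F x)) ^+ 2)%:E <= (e k ^+ 2)%:E)%E.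
  pose G l x := ((normc (cL2_fun (u k - u (l + k)%N) x)) ^+ 2)%:E.
  have mG l : measurable_fun setT (G l) by exact/measurable_sqr_normc/measurable_cL2.
  have G0 l x : (0 <= G l x)%E by rewrite lee_fin sqr_ge0.
  have mukF : measurable_fun setT (fun x => cL2_fun (u k) x - F x).
    rewrite (_ : (fun x => _) = fun x => cL2_fun (u k) x + (-1) * F x).
      by apply: measurable_cplxD => //; apply: measurable_cplxM.
    by apply/funext => x; rewrite mulN1r.
  apply: (@le_trans _ _ (\int[P]_x limn_einf (G^~ x))%E).
    rewrite le_eqVlt; apply/orP; left; apply/eqP; apply: ae_eq_integral => //.
    - exact: measurable_sqr_normc.
    - exact: measurable_fun_limn_einf.
    - have GE : {ae P, forall x l, cL2_fun (u k - u (l + k)%N) x =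
          cL2_fun (u k) x - cL2_fun (u (l + k)%N) x}.
        apply/ae_foralln => l.
        move: (cL2_funZD (-1) (u (l + k)%N) (u k)); apply: filterS => x h.
        by rewrite addrC -scaleN1r (h I) mulN1r addrC.
      move: uF GE; apply: filterS2 => x [Fre Fim] GE _.
      move: Fre Fim.
      rewrite -(cvg_shiftn k (fun l => Re (cL2_fun (u l) x))) => Fre.
      rewrite -(cvg_shiftn k (fun l => Im (cL2_fun (u l) x))) => Fim.
      suff Gx : G l x @[l --> \oo] --> ((normc (cL2_fun (u k) x - F x)) ^+ 2)%:E.
        rewrite is_cvg_limn_einfE; first by rewrite (cvg_lim _ Gx).
        by apply/cvg_ex; eexists; exact: Gx.
      rewrite /G; apply/cvg_EFin; first exact: nearW.
      rewrite /comp /= sqr_normc.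
      under eq_fun => l do rewrite GE sqr_normc !raddfB /=.
      rewrite !raddfB /=.
      apply: cvgD; rewrite /GRing.exp /=; apply: cvgM; (apply: cvgB; first exact: cvg_cst);
      [exact: Fre|exact: Fre|exact: Fim|exact: Fim].
  apply: le_trans (fatou _ _ _ _) _ => //.
  apply: le_trans (limn_einf_sup _) _; rewrite limn_esup_lim.
  apply: lime_le; first exact: is_cvg_esups.
  apply: nearW => l; apply: ub_ereal_sup => _ [m _ <-].
  rewrite integral_sqr_cL2 lee_fin ler_pXn2r ?nnegrE ?cL2_norm_ge0 ?(ltW (e0 _)) //.
  by rewrite cL2_normBC u_fast // leq_addl.
have [r rE] : exists r : L2,
    ae_eq P setT (cL2_fun r) (fun x => cL2_fun (u 0%N) x - F x).
  apply: cL2_of_sqr_integrable; last by apply: le_lt_trans (uk_le 0%N) (ltry _).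
  rewrite (_ : (fun x => _) = fun x => cL2_fun (u 0%N) x + (-1) * F x).
    by apply: measurable_cplxD => //; apply: measurable_cplxM.
  by apply/funext => x; rewrite mulN1r.
exists (u 0%N - r) => k.
rewrite -(@ler_pXn2r _ 2) ?nnegrE ?cL2_norm_ge0 ?(ltW (e0 _)) // -lee_fin.
rewrite -integral_sqr_cL2; apply: le_trans (uk_le k).
rewrite le_eqVlt; apply/orP; left; apply/eqP; apply: ae_eq_integral => //.
- exact/measurable_sqr_normc/measurable_cL2.
- apply: measurable_sqr_normc.
  rewrite (_ : (fun x => _) = fun x => cL2_fun (u k) x + (-1) * F x).
    by apply: measurable_cplxD => //; apply: measurable_cplxM.
  by apply/funext => x; rewrite mulN1r.
move: rE (cL2_funZD (-1) (u 0%N - r) (u k)) (cL2_funZD (-1) r (u 0%N)).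
apply: filterS3 => x h1 h2 h3 _; congr ((normc _ ^+ 2)%:E).
rewrite addrC -scaleN1r (h2 I) addrC; congr (_ + _); rewrite mulN1r; congr (- _).
by rewrite addrC -scaleN1r (h3 I) (h1 I) mulN1r opprB addrNK.
Qed.

Definition cvg_cL2 u f : Prop := N (u k - f) @[k --> \oo] --> (0 : R).

Lemma cL2_complete u :
  (forall e : R, 0 < e -> exists n, forall k l, (n <= k)%N -> (n <= l)%N ->
     N (u k - u l) <= e) ->
  exists f, cvg_cL2 u f.
Proof.
move=> cau.
have half0 i : 0 < (2^-1 : R) ^+ i by rewrite exprn_gt0 // invr_gt0.
have /choice[n nP] i := cau _ (half0 i).
(* A subsequence fast enough for [riesz_fischer_fast]; the maximum is there
   because [n] may fail to be monotone. *)
pose m i := (\max_(j < i.+1) n j)%N.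
have nm i j : (i <= j)%N -> (n i <= m j)%N.
  rewrite -ltnS => ij.
  exact: (@leq_bigmax _ (fun k : 'I_j.+1 => n k) (Ordinal ij)).
have [f fP] : exists f, forall i, N (u (m i) - f) <= 2^-1 ^+ i.
  by apply: riesz_fischer_fast => i j ij; apply: nP; exact: nm.
exists f; apply/cvgrPdist_le => /= e e0.
have [i ie] : exists i, 2^-1 ^+ i + 2^-1 ^+ i <= e.
  have /cvgrPdist_le /(_ (e / 2)) : ((2^-1 : R) ^+ i @[i --> \oo] --> (0 : R)).
    by apply: cvg_expr; rewrite ger0_norm ?invr_ge0 // invf_lt1 // ltr1n.
  rewrite divr_gt0 // => /(_ isT) [i _ /(_ i (leqnn i))] /=.
  rewrite sub0r normrN (ger0_norm (ltW (half0 i))) => h.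
  by exists i; rewrite [leRHS]splitr lerD.
exists (n i) => // k /= nk.
rewrite sub0r normrN ger0_norm ?cL2_norm_ge0 //.
apply: le_trans ie; apply: le_trans (cL2_dist_triangle _ (u (m i)) _) _.
by apply: lerD => //; apply: nP => //; exact: nm.
Qed.

End completeness.

(** * Orthogonal projection *)

Section projection.
Context {R : realType} d (T : measurableType d) (P : probability T R).
Local Notation L2 := (cL2 P).
Implicit Types (f g h : L2) (u : nat -> L2).
Local Notation N := (@cL2_norm R d T P).

Lemma normc_lipschitz (z w : R[i]) : `|normc z - normc w| <= normc (z - w).
Proof.
have h1 := ler_normcD (z - w) w; have h2 := ler_normcD (w - z) z.
move: h1 h2; rewrite !subrK -[w - z]opprB normcN => h1 h2.
by rewrite ler_norml; apply/andP; split; lra.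
Qed.

Lemma cL2_norm_lipschitz f g : `|N f - N g| <= N (f - g).
Proof.
have h1 := cL2_normD (f - g) g; have h2 := cL2_normD (g - f) f.
move: h1 h2; rewrite !subrK [N (g - f)]cL2_normBC => h1 h2.
by rewrite ler_norml; apply/andP; split; lra.
Qed.

Lemma cvg_cL2P u f : cvg_cL2 u f <->
  forall e : R, 0 < e -> \forall k \near \oo, N (u k - f) <= e.
Proof.
split=> [/cvgrPdist_le uf e e0|uf].
  move: (uf e e0); apply: filterS => k.
  by rewrite sub0r normrN ger0_norm ?cL2_norm_ge0.
apply/cvgrPdist_le => e e0; move: (uf e e0); apply: filterS => k.
by rewrite sub0r normrN ger0_norm ?cL2_norm_ge0.
Qed.

Lemma cvg_cL2_norm u f : cvg_cL2 u f -> N (u k) @[k --> \oo] --> N f.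
Proof.
move=> /cvg_cL2P uf; apply/cvgrPdist_le => /= e /uf; apply: filterS => k.
by apply: le_trans; rewrite cL2_normBC cL2_norm_lipschitz.
Qed.

Lemma cvg_normc_cdot u f g (c : R[i]) : cvg_cL2 u f ->
  normc (cdot (u k) g - c) @[k --> \oo] --> normc (cdot f g - c).
Proof.
move=> /cvg_cL2P uf; apply/cvgrPdist_le => /= e e0.
have g1 : 0 < N g + 1 by rewrite ltr_wpDl // cL2_norm_ge0.
have /uf : 0 < e / (N g + 1) by rewrite divr_gt0.
apply: filterS => k uk; apply: le_trans (normc_lipschitz _ _) _.
rewrite opprB addrA subrK -cdotBl.
apply: le_trans (cauchy_schwarz _ _) _; rewrite cL2_normBC.
rewrite -[leRHS](divfK (lt0r_neq0 g1)) ler_pM ?cL2_norm_ge0 //.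
by rewrite lerDl.
Qed.

Lemma cdot_cvg_near u f g (c : R[i]) : cvg_cL2 u f ->
  (\forall k \near \oo, cdot (u k) g = c) -> cdot f g = c.
Proof.
move=> uf uc; apply/eqP; rewrite -subr_eq0; apply/eqP/normc_eq0.
have /cvg_lim <- // := @cvg_normc_cdot _ _ g c uf.
apply/cvg_lim => //; apply: cvg_near_cst; apply: filterS uc => k ->.
by rewrite subrr Normc.normc0.
Qed.

Lemma cdot_cvg_le u f g (M : R) : cvg_cL2 u f ->
  (forall k, normc (cdot (u k) g) <= M * N (u k)) ->
  normc (cdot f g) <= M * N f.
Proof.
move=> uf uM.
have := @cvg_normc_cdot _ _ g 0 uf; rewrite subr0.
under eq_fun do rewrite subr0.
move=> ug; have MN : M * N (u k) @[k --> \oo] --> M * N f.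
  by apply: cvgM (cvg_cL2_norm uf); exact: cvg_cst.
rewrite -(cvg_lim _ ug) // -(cvg_lim _ MN) //.
by apply: ler_lim; [apply/cvg_ex; exists (normc (cdot f g))|
  apply/cvg_ex; exists (M * N f)|exact: nearW].
Qed.

(** If the length of [g] is nearly minimal among the [g - a *: f], then [g] is
    nearly orthogonal to [f]: otherwise removing the component of [g] along [f]
    would shorten it too much. *)
Lemma near_minimizer_cdot f g (e m : R) : 0 <= e ->
  (N g) ^+ 2 <= m + e ^+ 2 -> (forall a, m <= (N (g - a *: f)) ^+ 2) ->
  normc (cdot g f) <= e * N f.
Proof.
move=> e0 gm mle; have [f0|f0] := eqVneq (N f) 0.
  by rewrite (cL2_norm_eq0 f0) cdot0r Normc.normc0 cL2_norm0 mulr0.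
have gt0 : 0 < (N f) ^+ 2 by rewrite exprn_gt0 // lt_neqAle eq_sym f0 cL2_norm_ge0.
rewrite -(@ler_pXn2r _ 2) ?nnegrE ?mulr_ge0 ?cL2_norm_ge0 ?normc_ge0 //.
rewrite exprMn -ler_pdivrMr //.
have := mle (((N f) ^- 2)%:C * cdot g f); rewrite sqr_cL2_normB_scale //.
by lra.
Qed.

(** A minimizing sequence [s] for the distance to [g] is nearly orthogonal to
    the subspace. Since [s k - s l] lies in the subspace, its squared norm is a
    difference of two small inner products, so [s] is a Cauchy sequence. The
    projection [h] is stated as a limit of points of [S] because [S] may fail to
    be closed. *)
Lemma cL2_projection (S : set L2) g : S 0 ->
  (forall a f h, S f -> S h -> S (a *: f + h)) ->
  exists s h, [/\ forall k, S (s k), cvg_cL2 s h &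
    forall f, S f -> cdot (g - h) f = 0].
Proof.
move=> S0 Slin.
have SB f h : S f -> S h -> S (f - h).
  by move=> Sf Sh; rewrite addrC -scaleN1r; exact: Slin.
pose D : set R := [set (N (g - f)) ^+ 2 | f in S].
have D_inf : has_inf D.
  split; first by exists ((N (g - 0)) ^+ 2); exists 0.
  by exists 0 => _ [f _ <-]; exact: sqr_ge0.
pose e k : R := k.+1%:R^-1.
have e0 k : 0 < e k by rewrite invr_gt0.
have /choice[s sP] k : exists s, S s /\ (N (g - s)) ^+ 2 < inf D + e k ^+ 2.
  have [_ [f Sf <-] fD] := inf_adherent (exprn_gt0 2 (e0 k)) D_inf.
  by exists f.
have Ss k : S (s k) by have [] := sP k.
have s_orth k f : S f -> normc (cdot (g - s k) f) <= e k * N f.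
  move=> Sf; apply: (@near_minimizer_cdot _ _ _ (inf D)); rewrite ?ltW //.
    by have [_] := sP k.
  move=> a; apply: ge_inf; first by have [_] := D_inf.
  by exists (a *: f + s k); [exact: Slin|rewrite opprD addrAC addrA].
have s_cau k l : N (s k - s l) <= e k + e l.
  have [->|w0] := eqVneq (N (s k - s l)) 0; first by rewrite addr_ge0 // ltW.
  have wgt0 : 0 < N (s k - s l) by rewrite lt_neqAle eq_sym w0 cL2_norm_ge0.
  rewrite -(ler_pM2r wgt0) -expr2.
  set w := s k - s l in wgt0 *.
  have Sw : S w by exact: SB.
  have -> : (N w) ^+ 2 = normc (cdot (g - s l) w - cdot (g - s k) w).
    have wE : w = (g - s l) - (g - s k) by rewrite opprB addrC addrA subrK.
    by rewrite -cdotBl -wE cdot_norm normc_real // sqr_ge0.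
  rewrite (le_trans (ler_normcD _ _)) // normcN addrC mulrDl.
  by rewrite lerD ?s_orth.
have [h sh] : exists h, cvg_cL2 s h.
  apply: cL2_complete => c c0.
  have [n nc] : exists n, e n + e n <= c.
    have /cvgrPdist_le /(_ (c / 2)) := @cvg_harmonic R.
    rewrite divr_gt0 // => /(_ isT) [n _ /(_ n (leqnn n))] /=.
    rewrite sub0r normrN (ger0_norm (ltW (e0 n))) => h.
    by exists n; rewrite [leRHS]splitr lerD.
  exists n => k l nk nl; apply: le_trans (s_cau k l) _; apply: le_trans nc.
  by rewrite lerD // lef_pV2 ?posrE // ler_nat ltnS.
exists s, h; split => // f Sf.
have gsh : cvg_cL2 (fun k => g - s k) (g - h).
  apply/cvg_cL2P => c c0; have /cvg_cL2P /(_ _ c0) := sh; apply: filterS => k.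
  have -> : g - s k - (g - h) = h - s k by rewrite opprB addrC addrA subrK.
  by rewrite cL2_normBC.
have := @cvg_normc_cdot _ _ f 0 gsh.
under eq_fun do rewrite subr0.
rewrite subr0 => cdot_lim; apply: normc_eq0.
rewrite -(cvg_lim _ cdot_lim) //; apply: cvg_lim => //.
apply: (squeeze_cvgr (f := fun=> 0) (h := fun k => e k * N f)).
- by apply: nearW => k; rewrite normc_ge0 s_orth.
- exact: cvg_cst.
- by rewrite -[0](mul0r (N f)); apply: cvgM (@cvg_harmonic R) _; exact: cvg_cst.
Qed.

End projection.

(** * Integrals of characters *)

Section integral_of_characters.
Context {R : realType}.

Lemma measurable_unimodular_exprz d (T : measurableType d) (w : T -> R[i]) (k : int) :
  measurable_fun setT w -> (forall x, normc (w x) = 1) ->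
  measurable_fun setT (fun x => w x ^ k).
Proof.
move=> mw w1.
have mX m : measurable_fun setT (fun x => w x ^+ m).
  elim: m => [|m IH]; first by under eq_fun do [rewrite expr0]; exact: measurable_cst.
  by under eq_fun do [rewrite exprS]; exact: measurable_cplxM.
case: k => m; first exact: mX.
under eq_fun => x.
  rewrite NegzE -exprnN invc_unit; last by rewrite normcX w1 expr1n.
  over.
exact: measurable_conjc.
Qed.

Lemma normc_unimodular_exprz (w : R[i]) (k : int) : normc w = 1 -> normc (w ^ k) = 1.
Proof.
move=> w1; case: k => m; first by rewrite -exprnP normcX w1 expr1n.
by rewrite NegzE -exprnN Normc.normcV normcX w1 expr1n invr1.
Qed.

Lemma normc_circle_val (z : circle R) : normc (circle_val z) = 1.
Proof. exact/eqP/(valP z). Qed.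

Lemma bounded_integrable d (T : measurableType d) (P : probability T R)
    (g : T -> R) (M : R) :
  measurable_fun setT g -> (forall x, `|g x| <= M) -> P.-integrable setT (EFin \o g).
Proof.
move=> mg gM; apply: (@le_integrable _ _ _ _ _ _ _ (cst M%:E)) => //.
- exact/measurable_EFinP.
- by move=> x _ /=; rewrite lee_fin (le_trans (gM x)) // ler_norm.
- exact: finite_measure_integrable_cst.
Qed.

Lemma cintegral_distribution d d' (T : measurableType d) (T' : measurableType d')
    (P : probability T R) (X : {RV P >-> T'}) (F : T' -> R[i]) (M : R) :
  measurable_fun setT F -> (forall x, normc (F x) <= M) ->
  cintegral (distribution P X) F = cintegral P (F \o X).
Proof.
move=> /measurable_complexP[mr mi] FM.
rewrite /cintegral; congr (_ +i* _); rewrite /Rintegral; congr fine.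
  rewrite (@integral_distribution _ _ _ _ _ P X (fun x => (Re (F x))%:E)) //.
    exact/measurable_EFinP.
  apply: (@bounded_integrable _ _ _ (fun x => Re (F (X x))) M) => [|x].
    exact: (measurableT_comp mr).
  exact: le_trans (normc_Re _) (FM _).
rewrite (@integral_distribution _ _ _ _ _ P X (fun x => (Im (F x))%:E)) //.
  exact/measurable_EFinP.
apply: (@bounded_integrable _ _ _ (fun x => Im (F (X x))) M) => [|x].
  exact: (measurableT_comp mi).
exact: le_trans (normc_Im _) (FM _).
Qed.

Section product.
Context d1 d2 (T1 : measurableType d1) (T2 : measurableType d2).
Context (P1 : probability T1 R) (P2 : probability T2 R).

Lemma Rintegral_prod (a : T1 -> R) (b : T2 -> R) :
  measurable_fun setT a -> measurable_fun setT b ->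
  (forall x, `|a x| <= 1) -> (forall y, `|b y| <= 1) ->
  \int[(P1 \x P2)%E]_p (a p.1 * b p.2) = (\int[P1]_x a x) * (\int[P2]_y b y).
Proof.
move=> ma mb a1 b1.
have ia := bounded_integrable P1 ma a1; have ib := bounded_integrable P2 mb b1.
have mab : measurable_fun setT (fun p : T1 * T2 => a p.1 * b p.2).
  by apply: measurable_funM; apply: measurableT_comp.
have iab : (P1 \x P2)%E.-integrable setT (EFin \o (fun p : T1 * T2 => a p.1 * b p.2)).
  by apply: (@bounded_integrable _ _ _ _ 1 mab) => p; rewrite normrM mulr_ile1.
rewrite {1}/Rintegral -(integral12_prod_meas1 iab) -RintegralZr //.
congr fine; apply: eq_integral => x _; rewrite /fubini_F /=.
transitivity (\int[P2]_y ((a x)%:E * (b y)%:E))%E; first exact: eq_integral.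
rewrite integralZl // EFinM; congr (_ * _)%E.
by rewrite fineK //; exact: integrable_fin_num.
Qed.

Lemma cintegral_prod (A : T1 -> R[i]) (B : T2 -> R[i]) :
  measurable_fun setT A -> measurable_fun setT B ->
  (forall x, normc (A x) <= 1) -> (forall y, normc (B y) <= 1) ->
  cintegral (P1 \x P2)%E (fun p => A p.1 * B p.2) = cintegral P1 A * cintegral P2 B.
Proof.
move=> /measurable_complexP[mAr mAi] /measurable_complexP[mBr mBi] A1 B1.
have Ar x : `|Re (A x)| <= 1 by exact: le_trans (normc_Re _) (A1 x).
have Ai x : `|Im (A x)| <= 1 by exact: le_trans (normc_Im _) (A1 x).
have Br x : `|Re (B x)| <= 1 by exact: le_trans (normc_Re _) (B1 x).
have Bi x : `|Im (B x)| <= 1 by exact: le_trans (normc_Im _) (B1 x).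
have iM (a : T1 -> R) (b : T2 -> R) : measurable_fun setT a -> measurable_fun setT b ->
    (forall x, `|a x| <= 1) -> (forall y, `|b y| <= 1) ->
    (P1 \x P2)%E.-integrable setT (EFin \o (fun p : T1 * T2 => a p.1 * b p.2)).
  move=> ma mb a1 b1; apply: (@bounded_integrable _ _ _ _ 1).
    by apply: measurable_funM; apply: measurableT_comp.
  by move=> p; rewrite normrM mulr_ile1.
rewrite /cintegral; simpc.
rewrite -(Rintegral_prod mAr mBr) // -(Rintegral_prod mAi mBi) //.
rewrite -(Rintegral_prod mAr mBi) // -(Rintegral_prod mAi mBr) //.
rewrite -RintegralB //; [|exact: iM mAr mBr Ar Br|exact: iM mAi mBi Ai Bi].
rewrite -RintegralD //; [|exact: iM mAr mBi Ar Bi|exact: iM mAi mBr Ai Br].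
by congr (_ +i* _); apply: eq_Rintegral => p _; case: (A _) (B _) => [? ?] [? ?].
Qed.

End product.

Lemma de_moivre (t : R) (k : int) :
  (cos t +i* sin t) ^ k = cos (k%:~R * t) +i* sin (k%:~R * t).
Proof.
have nat_case (m : nat) :
    (cos t +i* sin t) ^+ m = cos (m%:R * t) +i* sin (m%:R * t).
  elim: m => [|m IH]; first by rewrite expr0 mul0r cos0 sin0.
  rewrite exprS IH -natr1 mulrDl mul1r [_ + t]addrC cosD sinD; simpc.
  by rewrite [in X in _ +i* X]addrC.
case: k => m; first by rewrite -exprnP nat_case.
rewrite NegzE -exprnN nat_case invc_unit /=; last by rewrite cos2Dsin2 sqrtr1.
by rewrite mulrNz mulNr cosN sinN.
Qed.

Lemma uniform_mean0 (g G : R -> R) : continuous g -> (forall t, `|g t| <= 1) ->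
  (forall t : R, is_derive t 1 G (g t)) -> G 0 = G (2 * pi) ->
  \int[uniform_prob (@twopi_gt0 R)]_t g t = 0.
Proof.
move=> cg g1 dG G0.
set P := uniform_prob _.
have mg : measurable_fun setT g by exact: continuous_measurable_fun.
have ig : P.-integrable setT (EFin \o g) by exact: (@bounded_integrable _ _ P g 1).
have i1 : P.-integrable setT (EFin \o (fun=> 1 : R)).
  by apply: (@bounded_integrable _ _ P _ 1) => // x; rewrite normr1.
(* The shift by 1 makes the integrand nonnegative. *)
have : \int[P]_t (g t + 1) = 1.
  have dGt (t : R) : is_derive t 1 (G + id) (g t + 1).
    exact: is_deriveD (dG t) (is_derive_id t 1).
  have dG1 (t : R) : derivable (G + id) t 1 by exact: (@ex_derive _ _ _ _ _ _ _ (dGt t)).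
  rewrite /Rintegral integral_uniform; first last.
  - by move=> t; rewrite lee_fin; have := g1 t; rewrite ler_norml => /andP[]; lra.
  - by apply/measurable_EFinP; apply: measurable_funD.
  rewrite (@continuous_FTC2 _ _ (G + id)) //.
  - rewrite -EFinB -EFinM /=; have addE (t : R) : (G + id) t = G t + t by [].
    rewrite !addE G0; move: (G _) (@twopi_gt0 R) => c; move: (2 * pi) => p p0.
    by field; exact: lt0r_neq0.
  - exact: twopi_gt0.
  - apply: continuous_subspaceT => t; apply: cvgD; first exact: cg. exact: cvg_cst.
  - have cG (t : R) : {for t, continuous (G + id)}.
      exact/differentiable_continuous/derivable1_diffP.
    split; first by move=> t _.
      exact: cvg_at_right_filter (cG _).
    exact: cvg_at_left_filter (cG _).
  - by move=> t _; rewrite derive1E (@derive_val _ _ _ _ _ _ _ (dGt t)).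
have PT : fine (P setT) = 1 by have -> : P setT = 1%E by exact: probability_setT.
rewrite RintegralD // Rintegral_cst // PT mul1r => g1E.
by apply: (addIr 1); rewrite g1E add0r.
Qed.

Lemma is_derive_rescale (f : R -> R) (c df t : R) : c != 0 ->
  is_derive (c * t) 1 f df -> is_derive t 1 (fun t => c^-1 * f (c * t)) df.
Proof.
move=> c0 fd; have cd : is_derive t (1 : R) ( *%R c) c.
  by apply: is_derive_eq (is_deriveZ c (is_derive_id t 1)) _; rewrite [LHS]mulr1.
apply: is_derive_eq (is_deriveZ c^-1 (is_derive1_comp fd cd)) _.
by rewrite [LHS]mulrCA mulVf // mulr1.
Qed.

Lemma cos_sin_2pi_mulrz (k : int) :
  cos (k%:~R * (2 * pi)) = 1 :> R /\ sin (k%:~R * (2 * pi)) = 0 :> R.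
Proof.
have := de_moivre (2 * pi) k.
rewrite mulr_natl cos2pi sin2pi exp1rz.
by move=> /eqP; rewrite eq_complex /= => /andP[/eqP <- /eqP <-].
Qed.

Lemma cintegral_circle_exprz (k : int) : k != 0 ->
  cintegral (@arc_length R) (fun z => circle_val z ^ k) = 0.
Proof.
move=> k0; set c : R := k%:~R; have c0 : c != 0 by rewrite intr_eq0.
have cont_scale (f : R -> R) : continuous f -> continuous (fun t => f (c * t)).
  move=> cf t; apply: (@continuous_comp _ _ _ (fun t => c * t) f); last exact: cf.
  exact: mulrl_continuous.
have [cosc sinc] := cos_sin_2pi_mulrz k.
rewrite /arc_length (@cintegral_distribution _ _ _ _ _ _ _ 1) //; first last.
- by move=> z; rewrite normc_unimodular_exprz ?normc_circle_val.
- apply: measurable_unimodular_exprz; last exact: normc_circle_val.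
  exact: measurable_circle_val.
rewrite /cintegral; congr (_ +i* _).
- transitivity (\int[uniform_prob (@twopi_gt0 R)]_t cos (c * t)).
    by apply: eq_Rintegral => t _; rewrite /= de_moivre.
  apply: (@uniform_mean0 _ (fun t => c^-1 * sin (c * t))).
    + exact/cont_scale/continuous_cos.
    + by move=> t; rewrite ler_norml cos_geN1 cos_le1.
    + by move=> t; apply: is_derive_rescale.
    + by rewrite sinc mulr0 sin0.
- transitivity (\int[uniform_prob (@twopi_gt0 R)]_t sin (c * t)).
    by apply: eq_Rintegral => t _; rewrite /= de_moivre.
  apply: (@uniform_mean0 _ (fun t => c^-1 * - cos (c * t))).
    + exact/cont_scale/continuous_sin.
    + by move=> t; rewrite ler_norml sin_geN1 sin_le1.
    + move=> t; apply: (@is_derive_rescale (fun t => - cos t)) => //.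
      by apply: is_derive_eq (is_deriveN (is_derive_cos _)) _; rewrite opprK.
    + by rewrite cosc mulr0 cos0.
Qed.

Lemma coordz_torus_cons n (p : circle R * torus R n) (i : 'I_n) :
  coordz (lift ord0 i) (torus_cons p) = coordz i p.2.
Proof. by rewrite /coordz /torus_cons tnthS. Qed.

(** The integral factors over the coordinates, and the factor of index [j] is
    the mean of a nontrivial character of the circle. *)
Lemma cintegral_zmono n (k : 'I_n -> int) (j : 'I_n) : k j != 0 ->
  cintegral (@haar R n) (zmono k) = 0.
Proof.
elim: n => [|n IH] in k j *; first by case: j.
move=> kj0; rewrite /= (@cintegral_distribution _ _ _ _ _ _ _ 1); first last.
- by move=> z; rewrite normc_zmono.
- exact: measurable_zmono.
have zE : zmono k \o @torus_cons R n =
    fun p => circle_val p.1 ^ k ord0 * zmono (fun i => k (lift ord0 i)) p.2.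
  apply/funext => p; rewrite /zmono /= big_ord_recl; congr (_ * _).
  by apply: eq_bigr => i _; rewrite coordz_torus_cons.
rewrite zE.
rewrite (@cintegral_prod _ _ _ _ (@arc_length R) (haar n)
  (fun z => circle_val z ^ k ord0)); first last.
- by move=> z; rewrite normc_zmono.
- by move=> z; rewrite normc_unimodular_exprz ?normc_circle_val.
- exact: measurable_zmono.
- apply: measurable_unimodular_exprz; last exact: normc_circle_val.
  exact: measurable_circle_val.
case: (unliftP ord0 j) => [i ji|j0].
  by rewrite (IH _ i) ?mulr0 // -ji.
by rewrite cintegral_circle_exprz ?mul0r // -j0.
Qed.

End integral_of_characters.

(** * Algebras of functions closed under bounded limits *)

(** The model is the set of bounded functions that are measurable for some
    sigma-algebra: the indicators in [D] come from a sigma-algebra that contains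
    the superlevel sets of the members of [D]. *)
Definition bounded_limit_algebra {R : realType} (T : Type) (D : set (T -> R)) :=
  [/\ forall c, D (fun=> c),
      forall g h, D g -> D h -> D (fun x => g x + h x),
      forall g h, D g -> D h -> D (fun x => g x * h x),
      forall g, D g -> exists M : R, forall x, `|g x| <= M &
      forall (g_ : nat -> T -> R) (g : T -> R) (M : R), (forall m, D (g_ m)) ->
        (forall m x, `|g_ m x| <= M) ->
        (forall x, g_ m x @[m --> \oo] --> g x) -> D g].

Section bounded_limit_algebras.
Context {R : realType}.

Lemma expRN_le_harmonic (k : nat) : expR (- k%:R) <= k.+1%:R^-1 :> R.
Proof.
rewrite expRN lef_pV2 ?posrE ?expR_gt0 // -natr1 addrC.
exact: expR_ge1Dx.
Qed.

(** The inner exponent tends to [-oo] when [0 < x] and is at least [k] when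
    [x <= 0], so that the boundary point [x = 0] falls on the right side. *)
Lemma cvg_step (x : R) :
  expR (- expR (k%:R * (1 - k%:R * x))) @[k --> \oo] --> ((0 < x)%R%:R : R).
Proof.
have [x0|x0] := ltP 0 x.
  apply: (squeeze_cvgr (f := fun k => 1 - k.+1%:R^-1) (h := fun=> 1)).
  - have [m xm] : exists m : nat, 2 / x <= m%:R.
      by exists (Num.truncn (2 / x)).+1; rewrite ltW // truncnS_gt.
    exists m => // k /= mk; rewrite -expR0 ler_expR oppr_le0 expR_ge0 andbT expR0.
    have kx : 2 <= k%:R * x.
      by rewrite -ler_pdivrMr // (le_trans xm) // ler_nat.
    apply: le_trans (expR_ge1Dx _); rewrite lerD2l lerN2.
    apply: le_trans (expRN_le_harmonic k); rewrite ler_expR -[leRHS]mulrN1.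
    by rewrite ler_wpM2l // lerBlDl; lra.
  - rewrite -[X in _ --> X]subr0; apply: cvgB; first exact: cvg_cst.
    exact: cvg_harmonic.
  - exact: cvg_cst.
apply: (squeeze_cvgr (f := fun=> 0) (h := fun k => k.+1%:R^-1)).
- apply: nearW => k; rewrite expR_ge0 /=.
  apply: le_trans (expRN_le_harmonic k); rewrite ler_expR lerN2.
  apply: (@le_trans _ _ (expR k%:R)).
    by apply: le_trans (expR_ge1Dx _); rewrite lerDr.
  rewrite ler_expR -[leLHS]mulr1 ler_wpM2l // lerDl oppr_ge0.
  by rewrite mulr_ge0_le0.
- exact: cvg_cst.
- exact: cvg_harmonic.
Qed.

Context {T : pointedType} (D : set (T -> R)) (D_alg : bounded_limit_algebra D).

Lemma bounded_limit_algebra_expR g : D g -> D (fun x => expR (g x)).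
Proof.
have [Dcst DD DM Dbnd Dlim] := D_alg => Dg.
have [M gM] := Dbnd g Dg.
apply: (Dlim (fun m x => series (exp_coeff (g x)) m) _ (expR M)).
- move=> m; rewrite /series /=; elim: m => [|m IH].
    by under eq_fun do [rewrite big_geq //]; exact: Dcst.
  under eq_fun do [rewrite big_nat_recr //=]; apply: (DD _ _) => //.
  apply: (DM _ _); last exact: Dcst.
  elim: m {IH} => [|m IH]; first by under eq_fun do [rewrite expr0]; exact: Dcst.
  by under eq_fun do [rewrite exprS]; exact: DM.
- move=> m x; have M0 : 0 <= M := le_trans (normr_ge0 _) (gM x).
  apply: (@le_trans _ _ (series (exp_coeff M) m)).
    rewrite /series /=; apply: le_trans (ler_norm_sum _ _ _) _.
    apply: ler_sum => i _; rewrite /exp_coeff /= normrM [X in _ * X]ger0_norm ?invr_ge0 //.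
    by rewrite ler_wpM2r ?invr_ge0 // normrX lerXn2r ?nnegrE.
  apply: nondecreasing_cvgn_le (is_cvg_series_exp_coeff M) m.
  by apply: nondecreasing_series => i _ _; exact: exp_coeff_ge0.
- by move=> x; exact: is_cvg_series_exp_coeff.
Qed.

(** A smooth approximation of a step by exponentials of exponentials, which
    are themselves limits of polynomials. *)
Lemma bounded_limit_algebra_superlevel g a : D g -> D (\1_[set x | a < g x]).
Proof.
have [Dcst DD DM Dbnd Dlim] := D_alg => Dg.
apply: (Dlim (fun k x => expR (- expR (k%:R * (1 - k%:R * (g x - a))))) _ 1).
- have DN h : D h -> D (fun x => - h x).
    by move=> Dh; under eq_fun do rewrite -mulN1r; exact: DM.
  move=> k; apply/bounded_limit_algebra_expR/DN/bounded_limit_algebra_expR.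
  apply: (DM _ _) => //; apply: (DD _ _) => //; apply: (DN _); apply: (DM _ _) => //.
  exact: DD.
- by move=> m x; rewrite ger0_norm ?expR_ge0 // expR_le1 oppr_le0 expR_ge0.
- move=> x; rewrite indicE (_ : (x \in _) = (0 < g x - a)); first exact: cvg_step.
  by rewrite subr_gt0; apply/idP/idP => [|xa]; rewrite inE.
Qed.

Lemma bounded_limit_algebra_sigma : sigma_algebra setT [set A | D (\1_A)].
Proof.
have [Dcst DD DM Dbnd Dlim] := D_alg.
have D0 : D (\1_set0) by rewrite indic0; exact: Dcst.
have DU A B : D (\1_A) -> D (\1_B) -> D (\1_(A `|` B)).
  move=> DA DB.
  rewrite (_ : \1_(A `|` B) = fun x => \1_A x + (\1_B x + (-1) * (\1_A x * \1_B x))).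
    by apply: (DD _ _) => //; apply: (DD _ _) => //; apply: (DM _ _) => //; exact: DM.
  apply/funext => x; rewrite !indicE in_setU.
  by case: (x \in A); case: (x \in B) => /=; ring.
split => //.
  move=> A DA /=; rewrite setTD.
  rewrite (_ : \1_(~` A) = fun x => 1 + (-1) * \1_A x).
    by apply: (DD _ _) => //; exact: DM.
  by apply/funext => x; rewrite !indicE in_setC; case: (x \in A) => /=; ring.
move=> F DF /=.
apply: (Dlim (fun m => \1_(\big[setU/set0]_(i < m) F i)) _ 1).
- by elim=> [|m IH]; rewrite ?big_ord0 // big_ord_recr /=; apply: DU => //; exact: DF.
- by move=> m x; rewrite indicE; case: (x \in _); rewrite /= ?normr1 ?normr0.
- move=> x; apply: cvg_near_cst; have [[i _ Fix]|nFx] := pselect ((\bigcup_i F i) x).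
    exists i.+1 => // m /= im; rewrite !indicE !mem_set //; first by exists i.
    by rewrite -bigcup_mkord; exists i.
  apply: nearW => m; rewrite !indicE !memNset //.
  by rewrite -bigcup_mkord => -[i _ Fix]; apply: nFx; exists i.
Qed.

End bounded_limit_algebras.

(** * Completeness of the characters *)

Section completeness_of_characters.
Context {R : realType} {n : nat}.
Local Notation mu := (@haar R n).
Local Notation L2 := (cL2 mu).
Implicit Types (f : L2) (k l : 'I_n -> int).

(** The sets with indicator in [D] form a sigma-algebra that makes the
    coordinates measurable, and the sigma-algebra of the torus is generated by
    the coordinates. *)
Lemma bounded_limit_algebra_torus (D : set (torus R n -> R)) (A : set (torus R n)) :
  bounded_limit_algebra D ->
  (forall j, D (fun z => Re (coordz j z))) ->
  (forall j, D (fun z => Im (coordz j z))) ->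
  measurable A -> D (\1_A).
Proof.
move=> D_alg DRe DIm mA.
pose G := [set A : set (torus R n) | D (\1_A)].
have sG : sigma_algebra setT G := bounded_limit_algebra_sigma D_alg.
have mG (g : torus R n -> R) : D g ->
    measurable_fun [set: g_sigma_algebraType G] (g : g_sigma_algebraType G -> R).
  move=> Dg; apply: (measurability _ (RGenOInfty.measurableE R)) => //.
  move=> _ [_ [a ->] <-]; rewrite setTI.
  rewrite measurable_g_measurableTypeE // /G /=.
  rewrite (_ : _ @^-1` _ = [set x | a < g x]).
    exact: bounded_limit_algebra_superlevel.
  by apply/seteqP; split => x /=; rewrite in_itv /= andbT.
have mid : measurable_fun [set: g_sigma_algebraType G]
    (fun z : g_sigma_algebraType G => z : torus R n).
  apply/measurable_fun_tnthP => j _ B [C mC <-]; rewrite !setTI.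
  have mj : measurable_fun [set: g_sigma_algebraType G]
      (fun z : g_sigma_algebraType G => coordz j (z : torus R n)).
    by apply/measurable_complexP; split; exact: mG.
  by have := mj measurableT _ mC; rewrite setTI.
by have := mid measurableT _ mA; rewrite setTI measurable_g_measurableTypeE.
Qed.

Lemma zmonoD k l (z : torus R n) : zmono (fun i => k i + l i) z = zmono k z * zmono l z.
Proof.
rewrite /zmono -big_split; apply: eq_bigr => i _ /=.
by rewrite expfzDr // coordz_neq0.
Qed.

Lemma zmono_unit j (z : torus R n) : zmono (fun i => (i == j)%:Z) z = coordz j z.
Proof.
rewrite /zmono (bigD1 j) //= eqxx expr1z big1 ?mulr1 // => i /negbTE ->.
by rewrite expr0z.
Qed.

Lemma zmonoN k (z : torus R n) : zmono (fun i => - k i) z = conjc (zmono k z) :> R[i].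
Proof.
rewrite -invc_unit ?normc_zmono // /zmono -prodfV; apply: eq_bigr => i _.
by rewrite invr_expz.
Qed.


Lemma Rintegral_dominated_eq0 d (T : measurableType d) (P : probability T R)
    (g_ : nat -> T -> R) (g G : T -> R) :
  (forall m, measurable_fun setT (g_ m)) -> measurable_fun setT g ->
  P.-integrable setT (EFin \o G) -> (forall m x, `|g_ m x| <= G x) ->
  (forall x, g_ m x @[m --> \oo] --> g x) ->
  (forall m, \int[P]_x g_ m x = 0) -> \int[P]_x g x = 0.
Proof.
move=> mg_ mg Gi gG gcvg g0.
have ig_ m : P.-integrable setT (EFin \o g_ m).
  apply: le_integrable Gi => //; first exact/measurable_EFinP.
  by move=> x _; rewrite lee_fin (le_trans (gG m x)) // ler_norm.
have [] := @dominated_convergence _ _ _ P _ measurableT (fun m => EFin \o g_ m)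
  (EFin \o g) (EFin \o G) _ _ _ Gi.
- by move=> m; exact/measurable_EFinP.
- exact/measurable_EFinP.
- apply: aeW => x _; apply/fine_cvgP; split; first exact: nearW.
  exact: gcvg.
- by apply: aeW => x m _; rewrite lee_fin gG.
move=> _ _; rewrite [X in X @ _ --> _](_ : _ = fun=> 0%E).
  by move=> /cvg_lim; rewrite lim_cst // /Rintegral => <-.
apply/funext => m /=; rewrite -[LHS]fineK; last exact: integrable_fin_num (ig_ m).
by congr (_%:E); exact: g0.
Qed.

Section multipliers.
Variable f : L2.

(** Requiring the condition for all exponents at once makes this set of
    functions stable under multiplication by characters. *)
Definition annihilated (h : torus R n -> R[i]) :=
  [/\ measurable_fun setT h, exists M : R, forall z, normc (h z) <= M &
    forall k, cintegral mu (fun z => cL2_fun f z * h z * zmono k z) = 0].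

(** Unlike the annihilated functions themselves, their multipliers are closed
    under products for free. *)
Definition multiplier (g : torus R n -> R) :=
  [/\ measurable_fun setT g, exists M : R, forall z, `|g z| <= M &
    forall h, annihilated h -> annihilated (fun z => (g z)%:C * h z)].

Lemma measurable_ofR (g : torus R n -> R) : measurable_fun setT g ->
  measurable_fun setT (fun z => (g z)%:C).
Proof.
by move=> mg; apply/measurable_complexP; split => //=; exact: measurable_cst.
Qed.

Lemma annihilator_measurable h k : measurable_fun setT h ->
  measurable_fun setT (fun z => cL2_fun f z * h z * zmono k z).
Proof.
move=> mh; apply: measurable_cplxM; last exact: measurable_zmono.
by apply: measurable_cplxM => //; exact: measurable_cL2.
Qed.

Lemma cL2_normc_integrable (M : R) :
  mu.-integrable setT (EFin \o (fun z => M * normc (cL2_fun f z))).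
Proof.
have : mu.-integrable setT (EFin \o (fun z => normc (cL2_fun f z))).
  apply/Lfun1_integrable; apply: Lfun_subset12 (cL2_Lfun f) => //.
  exact: fin_num_measure.
by move=> /(integrableZl measurableT M).
Qed.

Lemma annihilator_bound h k (M : R) (z : torus R n) : normc (h z) <= M ->
  normc (cL2_fun f z * h z * zmono k z) <= M * normc (cL2_fun f z).
Proof.
move=> hM; rewrite !Normc.normcM normc_zmono mulr1 mulrC.
by rewrite ler_wpM2r // normc_ge0.
Qed.

Lemma annihilator_integrable h k : measurable_fun setT h ->
  (exists M : R, forall z, normc (h z) <= M) ->
  cintegrable mu (fun z => cL2_fun f z * h z * zmono k z).
Proof.
move=> mh [M hM]; apply: cintegrable_dominated (cL2_normc_integrable M) _.
  exact: annihilator_measurable.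
by move=> z; exact: annihilator_bound.
Qed.

Lemma annihilatedD h1 h2 : annihilated h1 -> annihilated h2 ->
  annihilated (fun z => h1 z + h2 z).
Proof.
move=> [m1 b1 i1] [m2 b2 i2]; split; first exact: measurable_cplxD.
  case: b1 b2 => [M1 h1M] [M2 h2M]; exists (M1 + M2) => z.
  by rewrite (le_trans (ler_normcD _ _)) // lerD.
move=> k; under eq_fun do rewrite mulrDr mulrDl.
rewrite cintegralD ?i1 ?i2 ?addr0 //; exact: annihilator_integrable.
Qed.

Lemma annihilatedZ a h : annihilated h -> annihilated (fun z => a * h z).
Proof.
move=> [mh bh ih]; split; first exact: measurable_cplxM.
  case: bh => M hM; exists (normc a * M) => z.
  by rewrite Normc.normcM ler_wpM2l // normc_ge0.
move=> k; under eq_fun do rewrite [cL2_fun f _ * _]mulrCA -[a * _ * _]mulrA.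
rewrite cintegralZ ?ih ?mulr0 //; exact: annihilator_integrable.
Qed.

Lemma annihilated_zmono l h : annihilated h -> annihilated (fun z => zmono l z * h z).
Proof.
move=> [mh bh ih]; split.
- by apply: measurable_cplxM => //; exact: measurable_zmono.
- case: bh => M hM; exists M => z.
  by rewrite Normc.normcM normc_zmono mul1r.
- move=> k; rewrite -(ih (fun i => l i + k i)); congr cintegral.
  by apply/funext => z; rewrite zmonoD; ring.
Qed.

Lemma annihilated_lim (h_ : nat -> torus R n -> R[i]) h (M : R) :
  (forall m, annihilated (h_ m)) -> measurable_fun setT h ->
  (forall m z, normc (h_ m z) <= M) -> (forall z, normc (h z) <= M) ->
  (forall z, normc (h_ m z - h z) @[m --> \oo] --> (0 : R)) ->
  annihilated h.
Proof.
move=> ann_ mh hM_ hM hcvg; split => //; first by exists M.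
move=> k; have mk := @annihilator_measurable _ k mh.
have mk_ m : measurable_fun setT (fun z => cL2_fun f z * h_ m z * zmono k z).
  by have [mh_ _ _] := ann_ m; exact: annihilator_measurable.
have hE z m :
    normc (cL2_fun f z * h_ m z * zmono k z - cL2_fun f z * h z * zmono k z) =
    normc (cL2_fun f z) * normc (h_ m z - h z).
  by rewrite -mulrBl -mulrBr !Normc.normcM normc_zmono mulr1.
have fcvg z : normc (cL2_fun f z) * normc (h_ m z - h z) @[m --> \oo] --> (0 : R).
  by rewrite -[0](mulr0 (normc (cL2_fun f z))); apply: cvgM; [exact: cvg_cst|].
have cvg0 (v : nat -> R) (w : R) (e : nat -> R) : (forall m, `|v m - w| <= e m) ->
    e m @[m --> \oo] --> (0 : R) -> v m @[m --> \oo] --> w.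
  move=> ve e0; apply/subr_cvg0/norm_cvg0P.
  apply: (squeeze_cvgr (f := fun=> 0) (h := e)) => //; last exact: cvg_cst.
  by apply: nearW => m; rewrite normr_ge0 ve.
move: mk => /measurable_complexP[mkr mki].
rewrite /cintegral; congr (_ +i* _).
  apply: (@Rintegral_dominated_eq0 _ _ mu
    (fun m z => Re (cL2_fun f z * h_ m z * zmono k z)) _ _ _ mkr
    (cL2_normc_integrable M)).
  - by move=> m; have /measurable_complexP[] := mk_ m.
  - by move=> m z; rewrite (le_trans (normc_Re _)) // annihilator_bound.
  - move=> z; apply: cvg0 (fcvg z) => m; rewrite -raddfB /= -hE; exact: normc_Re.
  - by move=> m; have [_ _ /(_ k) /eqP] := ann_ m; rewrite eq_complex /= => /andP[/eqP].
apply: (@Rintegral_dominated_eq0 _ _ mu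
  (fun m z => Im (cL2_fun f z * h_ m z * zmono k z)) _ _ _ mki
  (cL2_normc_integrable M)).
- by move=> m; have /measurable_complexP[] := mk_ m.
- by move=> m z; rewrite (le_trans (normc_Im _)) // annihilator_bound.
- move=> z; apply: cvg0 (fcvg z) => m; rewrite -raddfB /= -hE; exact: normc_Im.
- by move=> m; have [_ _ /(_ k) /eqP] := ann_ m; rewrite eq_complex /= => /andP[_ /eqP].
Qed.

Lemma multiplier_algebra : bounded_limit_algebra multiplier.
Proof.
split.
- move=> c; split; first exact: measurable_cst.
    by exists `|c|.
  by move=> h; exact: annihilatedZ.
- move=> g1 g2 [m1 [M1 b1] i1] [m2 [M2 b2] i2]; split.
  + exact: measurable_funD.
  + exists (M1 + M2) => z; by rewrite (le_trans (ler_normD _ _)) // lerD.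
  + move=> h ah; under eq_fun do rewrite rmorphD mulrDl.
    by apply: annihilatedD; [exact: i1|exact: i2].
- move=> g1 g2 [m1 [M1 b1] i1] [m2 [M2 b2] i2]; split.
  + exact: measurable_funM.
  + by exists (M1 * M2) => z; rewrite normrM ler_pM.
  + move=> h ah; under eq_fun do rewrite rmorphM -mulrA.
    exact/i1/i2.
- by move=> g [].
- move=> g_ g M mult_ gM gcvg.
  have mg_ m : measurable_fun setT (g_ m) by have [] := mult_ m.
  have mg : measurable_fun setT g by apply: measurable_fun_cvg => // z _; exact: gcvg.
  have gM' z : `|g z| <= M.
    have gn : `|g_ m z| @[m --> \oo] --> `|g z| by exact: cvg_norm.
    rewrite -(cvg_lim _ gn) //; apply: limr_le; first by apply/cvg_ex; exists `|g z|.
    exact: nearW.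
  split => //; first by exists M.
  move=> h ah; have [mh [K hK] _] := ah.
  have M0 (z : torus R n) : 0 <= M by exact: le_trans (normr_ge0 _) (gM' z).
  have norm_ofR (x : R) : normc x%:C = `|x| by rewrite /= expr0n addr0 sqrtr_sqr.
  apply: (@annihilated_lim (fun m z => (g_ m z)%:C * h z) _ (M * K)).
  + by move=> m; have [_ _] := mult_ m; exact.
  + by apply: measurable_cplxM => //; exact: measurable_ofR.
  + by move=> m z; rewrite Normc.normcM norm_ofR ler_pM // normc_ge0.
  + by move=> z; rewrite Normc.normcM norm_ofR ler_pM // normc_ge0.
  + move=> z; under eq_fun do rewrite -mulrBl -rmorphB Normc.normcM norm_ofR.
    rewrite -[0](mul0r (normc (h z))); apply: cvgM; last exact: cvg_cst.
    by apply/norm_cvg0P/subr_cvg0; exact: gcvg.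
Qed.

Lemma multiplier_trig (g : torus R n -> R) a b l1 l2 :
  measurable_fun setT g -> (forall z, `|g z| <= 1) ->
  (forall z, (g z)%:C = a * zmono l1 z + b * zmono l2 z) -> multiplier g.
Proof.
move=> mg g1 gE; split => //; first by exists 1.
move=> h ah; under eq_fun do rewrite gE mulrDl -!mulrA.
by apply: annihilatedD; apply/annihilatedZ/annihilated_zmono.
Qed.

(** On the circle the real part of [z] is the mean of [z] and its inverse. *)
Lemma multiplier_Re_coordz j : multiplier (fun z => Re (coordz j z)).
Proof.
have /measurable_complexP[mr mi] := @measurable_coordz R n j.
apply: (@multiplier_trig _ (2^-1)%:C (2^-1)%:C
  (fun i => (i == j)%:Z) (fun i => - (i == j)%:Z)) => // z.
  by rewrite (le_trans (normc_Re _)) // normc_coordz.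
rewrite zmonoN !zmono_unit; case: (coordz j z) => x y; apply/eqP.
rewrite eq_complex; apply/andP; split; apply/eqP => /=; by field.
Qed.

Lemma multiplier_Im_coordz j : multiplier (fun z => Im (coordz j z)).
Proof.
have /measurable_complexP[mr mi] := @measurable_coordz R n j.
apply: (@multiplier_trig _ (0 -i* 2^-1) (0 +i* 2^-1)
  (fun i => (i == j)%:Z) (fun i => - (i == j)%:Z)) => // z.
  by rewrite (le_trans (normc_Im _)) // normc_coordz.
rewrite zmonoN !zmono_unit; case: (coordz j z) => x y; apply/eqP.
rewrite eq_complex; apply/andP; split; apply/eqP => /=; by field.
Qed.

(** The real and imaginary parts of the coordinates are multipliers, hence so
    is the indicator of every measurable set. Thus [f] has integral [0] over
    every measurable set. *)
Lemma fourier_eq0 : (forall k, fourier f k = 0) -> f = 0.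
Proof.
move=> f0.
have ann1 : annihilated (fun=> 1).
  split; first exact: measurable_cst.
    by exists 1 => z; rewrite Normc.normc1.
  move=> k; rewrite -(f0 (fun i => - k i)); congr cintegral.
  apply/funext => z; rewrite mulr1; congr (_ * _).
  by rewrite -zmonoN; congr (zmono _ z); apply/funext => i; rewrite opprK.
have int0 A : measurable A ->
    cintegral mu (fun z => cL2_fun f z * (\1_A z)%:C) = 0.
  move=> mA.
  have [_ _ /(_ _ ann1)] : multiplier (\1_A).
    by apply: bounded_limit_algebra_torus mA; [exact: multiplier_algebra|
      exact: multiplier_Re_coordz|exact: multiplier_Im_coordz].
  move=> [_ _ /(_ (fun=> 0))] <-; congr cintegral; apply/funext => z.
  by rewrite mulr1 /zmono big1 ?mulr1 // => i _; rewrite expr0z.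
have [fr fi] : cintegrable mu (cL2_fun f).
  apply: cintegrable_dominated (cL2_normc_integrable 1) _.
    exact: measurable_cL2.
  by move=> z; rewrite mul1r.
have ae0 (g : torus R n -> R) : mu.-integrable setT (EFin \o g) ->
    (forall A, measurable A -> \int[mu]_z (g z * \1_A z) = 0) ->
    ae_eq mu setT g (cst 0).
  move=> ig g0.
  have : ae_eq mu setT (EFin \o g) (cst 0%E).
    apply: (integral_ae_eq measurableT ig) => [|A _ mA]; first exact: measurable_cst.
    rewrite [RHS]integral0 integral_mkcond epatch_indic.
    rewrite -[LHS]fineK; last first.
      apply: integrable_fin_num => //; rewrite -epatch_indic.
      by rewrite -integrable_mkcond //; apply: integrableS ig.
    congr (_%:E); rewrite -[RHS](g0 A mA); congr fine.
  by apply: filterS => z h zT; have [] := h zT.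
have int0Re A : measurable A -> \int[mu]_z (Re (cL2_fun f z) * \1_A z) = 0.
  move=> mA; have /eqP := int0 A mA; rewrite eq_complex /= => /andP[/eqP <- _].
  by apply: eq_Rintegral => z _; case: (cL2_fun f z) => x y /=; ring.
have int0Im A : measurable A -> \int[mu]_z (Im (cL2_fun f z) * \1_A z) = 0.
  move=> mA; have /eqP := int0 A mA; rewrite eq_complex /= => /andP[_ /eqP <-].
  by apply: eq_Rintegral => z _; case: (cL2_fun f z) => x y /=; ring.
apply/cL2P; move: (ae0 _ fr int0Re) (ae0 _ fi int0Im) (cL0_zeroE mu).
apply: filterS3 => z /(_ I) hr /(_ I) hi /(_ I) h0 _; rewrite [RHS]h0.
by move: hr hi; case: (cL2_fun f z) => x y /= -> ->.
Qed.

End multipliers.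
End completeness_of_characters.

(** * Characters as multipliers, and the Hardy space *)

Section bounded_multipliers.
Context {R : realType} d (T : measurableType d) (P : probability T R).
Local Notation L2 := (cL2 P).
Implicit Types (f g : L2) (p q : cLoo P).
Local Notation N := (@cL2_norm R d T P).

Lemma in_cLooP (f : cL0 P) (M : R) :
  {ae P, forall x, normc (cL0_fun f x) <= M} -> f \in in_cLp +oo%E.
Proof.
move=> fM; apply/asboolP.
rewrite /finite_norm unlock /= probability_setT lte01.
apply: (@le_lt_trans _ _ M%:E); last exact: ltry.
apply/ess_supP; apply: filterS fM => x h.
by rewrite /= lee_fin ger0_norm // normc_ge0.
Qed.

Definition Loo_of (f : cL0 P) (M : R)
    (fM : {ae P, forall x, normc (cL0_fun f x) <= M}) : cLoo P :=
  exist (fun f : cL0 P => f \in in_cLp +oo%E) f (in_cLooP fM).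

Lemma cmul_linear p a f g : cmul p (a *: f + g) = a *: cmul p f + cmul p g.
Proof.
apply/cL2P; near=> x => _.
rewrite (_ : cL2_fun (cmul p (a *: f + g)) x =
  cL0_fun (val p) x * cL2_fun (a *: f + g) x); last first.
  by near: x; apply: filterS (cmulE p (a *: f + g)) => x; exact.
rewrite (_ : cL2_fun (a *: f + g) x = a * cL2_fun f x + cL2_fun g x); last first.
  by near: x; apply: filterS (cL2_funZD a f g) => x; exact.
rewrite (_ : cL2_fun (a *: cmul p f + cmul p g) x =
  a * cL2_fun (cmul p f) x + cL2_fun (cmul p g) x); last first.
  by near: x; apply: filterS (cL2_funZD a (cmul p f) (cmul p g)) => x; exact.
rewrite (_ : cL2_fun (cmul p f) x = cL0_fun (val p) x * cL2_fun f x); last first.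
  by near: x; apply: filterS (cmulE p f) => x; exact.
rewrite (_ : cL2_fun (cmul p g) x = cL0_fun (val p) x * cL2_fun g x); last first.
  by near: x; apply: filterS (cmulE p g) => x; exact.
by rewrite mulrDr mulrCA.
Unshelve. all: by end_near. Qed.

Lemma cL2_norm_le_ae f g (M : R) : 0 <= M ->
  {ae P, forall x, normc (cL2_fun f x) <= M * normc (cL2_fun g x)} ->
  N f <= M * N g.
Proof.
move=> M0 fg.
rewrite -(@ler_pXn2r _ 2) ?nnegrE ?mulr_ge0 ?cL2_norm_ge0 // exprMn.
rewrite -lee_fin [leRHS]EFinM.
rewrite -(integral_sqr_cL2 f) -(integral_sqr_cL2 g) -ge0_integralZl //; first last.
- by rewrite lee_fin sqr_ge0.
- by move=> x _; rewrite lee_fin sqr_ge0.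
- exact/measurable_sqr_normc/measurable_cL2.
apply: ae_ge0_le_integral => //.
- by move=> x _; rewrite lee_fin sqr_ge0.
- exact/measurable_sqr_normc/measurable_cL2.
- by move=> x _; rewrite mule_ge0 // lee_fin sqr_ge0.
- by apply: emeasurable_funM => //; exact/measurable_sqr_normc/measurable_cL2.
apply: filterS fg => x fg _; rewrite -EFinM lee_fin -exprMn.
by rewrite lerXn2r // nnegrE ?mulr_ge0 ?normc_ge0.
Qed.

Lemma cdot_ae f f' g g' :
  ae_eq P setT (fun x => cL2_fun f x * conjc (cL2_fun g x))
    (fun x => cL2_fun f' x * conjc (cL2_fun g' x)) ->
  cdot f g = cdot f' g'.
Proof. by apply: ae_eq_cintegral; exact: measurable_mulJ. Qed.

End bounded_multipliers.

Section characters.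
Context {R : realType} {n : nat}.
Local Notation mu := (@haar R n).
Local Notation L2 := (cL2 mu).
Implicit Types (f g : L2) (k l : 'I_n -> int).
Local Notation N := (@cL2_norm R _ _ mu).

Fact zmono_ae_bound k :
  {ae mu, forall z, normc (cL0_fun (cclass mu (@measurable_zmono R n k)) z) <= 1}.
Proof.
apply: filterS (@cclassE _ _ _ mu _ (@measurable_zmono R n k)) => z h.
by rewrite (h I) normc_zmono.
Qed.

Definition zmono_Loo k : cLoo mu := Loo_of (zmono_ae_bound k).

(** These unitaries of [L^2], which form a group indexed by [k], extend the
    shifts of [H^2] and make them invertible. *)
Definition mulz k f : L2 := cmul (zmono_Loo k) f.

Lemma mulzE k f : ae_eq mu setT (cL2_fun (mulz k f)) (fun z => zmono k z * cL2_fun f z).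
Proof.
move: (cmulE (zmono_Loo k) f) (@cclassE _ _ _ mu _ (@measurable_zmono R n k)).
by apply: filterS2 => z h1 h2 _; rewrite (h1 I) -(h2 I).
Qed.

Fact mulz_linear k : linear (mulz k).
Proof. by move=> a f g; exact: cmul_linear. Qed.

HB.instance Definition _ k :=
  GRing.isLinear.Build R[i] L2 L2 _ (mulz k) (mulz_linear k).

Lemma mulzD k l f : mulz k (mulz l f) = mulz (k + l) f.
Proof.
apply/cL2P; move: (mulzE k (mulz l f)) (mulzE l f) (mulzE (k + l) f).
by apply: filterS3 => z h1 h2 h3 _; rewrite (h1 I) (h2 I) (h3 I) zmonoD mulrA.
Qed.

Lemma mulz0 f : mulz 0 f = f.
Proof.
apply/cL2P; move: (mulzE 0 f); apply: filterS => z h _; rewrite (h I).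
by rewrite /zmono big1 ?mul1r // => i _; rewrite expr0z.
Qed.

Lemma cdot_mulz k f g : cdot (mulz k f) g = cdot f (mulz (- k) g).
Proof.
apply: cdot_ae; move: (mulzE k f) (mulzE (- k) g); apply: filterS2 => z h1 h2 _.
by rewrite (h1 I) (h2 I) rmorphM /= zmonoN conjcK mulrCA mulrA.
Qed.

Lemma cdot_mulz2 k f g : cdot (mulz k f) (mulz k g) = cdot f g.
Proof. by rewrite cdot_mulz mulzD addNr mulz0. Qed.

Lemma cL2_norm_mulz k f : N (mulz k f) = N f.
Proof.
apply: (pexpIrn (n := 2)); rewrite ?nnegrE ?cL2_norm_ge0 //.
by rewrite !sqr_cL2_normE cdot_mulz2.
Qed.

Fact L2_one_subproof : exists f : L2, ae_eq mu setT (cL2_fun f) (fun=> 1).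
Proof.
apply: cL2_of_sqr_integrable; first exact: measurable_cst.
under eq_integral do rewrite Normc.normc1 expr1n.
by rewrite probability_integral_cst ltry.
Qed.

Definition L2_one : L2 := projT1 (cid L2_one_subproof).

Lemma L2_oneE : ae_eq mu setT (cL2_fun L2_one) (fun=> 1).
Proof. exact: projT2 (cid L2_one_subproof). Qed.

Lemma fourierE f k : fourier f k = cdot f (mulz k L2_one).
Proof.
apply: ae_eq_cintegral; [exact: measurable_fourier|exact: measurable_mulJ|].
move: (mulzE k L2_one) L2_oneE; apply: filterS2 => z h1 h2 _.
by rewrite (h1 I) (h2 I) mulr1.
Qed.

Lemma cdot_mulz_eq0 f : (forall k, cdot f (mulz k L2_one) = 0) -> f = 0.
Proof. by move=> f0; apply: fourier_eq0 => k; rewrite fourierE. Qed.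

End characters.

Section hardy_space.
Context {R : realType} {n : nat}.
Local Notation mu := (@haar R n).
Local Notation L2 := (cL2 mu).
Local Notation H2 := (H2 R n).
Local Notation inH2 := (@in_H2 R n).
Implicit Types (f g : L2) (k l : 'I_n -> int) (a b : 'I_n -> nat) (u v : H2).
Local Notation N := (@cL2_norm R _ _ mu).

Lemma in_H2_cdotP f : reflect
  (forall k, (exists j, k j < 0) -> cdot f (mulz k L2_one) = 0) (f \in inH2).
Proof.
apply: (iffP (in_H2P f)) => f0 k kn; first by rewrite -fourierE f0.
by rewrite fourierE f0.
Qed.

Definition intexp a : 'I_n -> int := fun i => (a i)%:Z.

Lemma mulz_H2 a f : f \in inH2 -> mulz (intexp a) f \in inH2.
Proof.
move=> /in_H2_cdotP f0; apply/in_H2_cdotP => k [j kj].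
rewrite cdot_mulz mulzD f0 //; exists j.
by rewrite [ltLHS](_ : _ = k j - (a j)%:Z) ?subr_lt0 ?(lt_le_trans kj) // addrC.
Qed.

Lemma L2_one_in_H2 : L2_one \in inH2.
Proof.
apply/in_H2P => k [j kj].
rewrite -(@cintegral_zmono R n (- k) j); last by rewrite oppr_eq0 lt_eqF.
apply: ae_eq_cintegral; [exact: measurable_fourier|exact: measurable_zmono|].
by move: (@L2_oneE R n); apply: filterS => z h _; rewrite (h I) mul1r zmonoN.
Qed.

Lemma in_H2_closed (u_ : nat -> L2) f :
  cvg_cL2 u_ f -> (forall m, u_ m \in inH2) -> f \in inH2.
Proof.
move=> uf u_H2; apply/in_H2_cdotP => k kn; apply: cdot_cvg_near uf _.
by apply: nearW => m; move/in_H2_cdotP : (u_H2 m) => ->.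
Qed.

Lemma val_H2_inj u v : val u = val v -> u = v.
Proof. exact: val_inj. Qed.

Lemma cdot_H2_inj u v : (forall w : H2, cdot (val u) (val w) = cdot (val v) (val w)) ->
  u = v.
Proof.
move=> uv; apply/val_H2_inj/eqP; rewrite -subr_eq0; apply/eqP/cL2_norm_eq0/eqP.
have uvE : val (u - v) = val u - val v by exact: (raddfB val).
have : cdot (val u - val v) (val (u - v)) = 0 by rewrite cdotBl uv subrr.
by rewrite uvE -sqrf_eq0 sqr_cL2_normE => ->.
Qed.

(** [H^2] is closed in [L^2], so the point provided by [cL2_projection] lies in
    it, and the choice that defines [projH2] is made in a nonempty set. *)
Lemma projH2P g u : cdot (g - val (projH2 g)) (val u) = 0.
Proof.
have [s [h [s_H2 sh h_orth]]] : exists s h, [/\ forall m, s m \in inH2,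
    cvg_cL2 s h & forall f, f \in inH2 -> cdot (g - h) f = 0].
  apply: (@cL2_projection _ _ _ _ (fun f => f \in inH2)); first exact: rpred0.
  by move=> c f f' fH f'H; rewrite rpredD // rpredZ.
have hH : h \in inH2 by exact: in_H2_closed sh s_H2.
have : [set h : H2 | forall u : H2, cdot (g - val h) (val u) = 0] (projH2 g).
  by apply: (@xgetPex _ 0); exists (exist _ h hH) => /= w; exact: h_orth (valP w).
exact.
Qed.

Lemma cdot_projH2 g u : cdot (val (projH2 g)) (val u) = cdot g (val u).
Proof. by apply/eqP; rewrite eq_sym -subr_eq0 -cdotBl projH2P. Qed.

Lemma cdot_projH2r g u : cdot (val u) (val (projH2 g)) = cdot (val u) g.
Proof. by rewrite [LHS]cdotC cdot_projH2 [RHS]cdotC. Qed.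

Definition unit_index (j : 'I_n) : 'I_n -> int := fun i => (i == j)%:Z.

Lemma val_Tz j u : val (Tz j u) = mulz (unit_index j) (val u).
Proof.
apply/cL2P; move: (mulzE (unit_index j) (val u)) (cmulE (coord_Loo j) (val u))
  (@cclassE _ _ _ mu _ (measurable_coordz j)).
apply: filterS3 => z h1 h2 h3 _; rewrite (h1 I) [LHS](h2 I) [X in X * _](h3 I).
by rewrite /unit_index zmono_unit.
Qed.

(** The adjoint of a shift exists: it is multiplication by the conjugate
    coordinate followed by the projection onto [H^2]. *)
Lemma adjoint_TzP j u v :
  cdot (val (Tz j u)) (val v) = cdot (val u) (val (adjoint (Tz j) v)).
Proof.
have : [set h : H2 | forall f : H2,
    cdot (val (Tz j f)) (val v) = cdot (val f) (val h)] (adjoint (Tz j) v).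
  apply: (@xgetPex _ 0); exists (projH2 (mulz (- unit_index j) (val v))) => f.
  by rewrite cdot_projH2r val_Tz cdot_mulz.
exact.
Qed.

(** An operator is determined by its sesquilinear form, and passing to the form
    trades the adjoint for a second shift. *)
Lemma adjoint_Tz_invariantP (A : H2 -> H2) j :
  adjoint (Tz j) \o A \o Tz j = A <->
  (forall u v, cdot (val (A (Tz j u))) (val (Tz j v)) = cdot (val (A u)) (val v)).
Proof.
split=> [AE u v|AE].
  rewrite [LHS]cdotC adjoint_TzP.
  by rewrite -[RHS](congr1 (fun B => cdot (val (B u)) (val v)) AE) [RHS]cdotC.
apply/funext => u; apply: cdot_H2_inj => v /=.
by rewrite [LHS]cdotC -adjoint_TzP -AE [RHS]cdotC.
Qed.

(** Multiplication by [z_j] commutes with multiplication by [phi] and preserves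
    inner products. *)
Lemma toeplitz_form_invariant (phi : cLoo mu) (A : H2 -> H2) j u v :
  (forall u v, cdot (val (A u)) (val v) = cdot (cmul phi (val u)) (val v)) ->
  cdot (val (A (Tz j u))) (val (Tz j v)) = cdot (val (A u)) (val v).
Proof.
move=> Aphi; rewrite (Aphi (Tz j u)) (Aphi u) (val_Tz j u) (val_Tz j v).
have -> : cmul phi (mulz (unit_index j) (val u)) =
    mulz (unit_index j) (cmul phi (val u)).
  apply/cL2P.
  have h1 := cmulE phi (mulz (unit_index j) (val u)).
  have h2 := mulzE (unit_index j) (val u).
  have h3 := mulzE (unit_index j) (cmul phi (val u)).
  have h4 := cmulE phi (val u).
  move: h1 h2 h3 h4; apply: filterS4 => z h1 h2 h3 h4 _.
  by rewrite (h1 I) (h2 I) (h3 I) (h4 I) mulrCA.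
exact: cdot_mulz2.
Qed.

End hardy_space.

(** * Trigonometric polynomials *)

Section trigonometric_polynomials.
Context {R : realType} {n : nat}.
Local Notation mu := (@haar R n).
Local Notation L2 := (cL2 mu).
Local Notation H2 := (H2 R n).
Local Notation inH2 := (@in_H2 R n).
Local Notation N := (@cL2_norm R _ _ mu).
Local Notation trigpoly := (seq (R[i] * ('I_n -> int))).
Local Notation anapoly := (seq (R[i] * ('I_n -> nat))).
Implicit Types (f g : L2) (k l : 'I_n -> int) (a b : 'I_n -> nat) (u v : H2).
Implicit Types (s t : trigpoly) (p q : anapoly).

(** The list [s] stands for the trigonometric polynomial with terms [x.1 z^x.2];
    as an element of [L^2] this polynomial is [mul_trig s L2_one]. *)
Definition mul_trig s f : L2 := \sum_(x <- s) x.1 *: mulz x.2 f.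

Definition trig_of p : trigpoly := [seq (x.1, intexp x.2) | x <- p].

Definition trig_eval s (z : torus R n) : R[i] := \sum_(x <- s) x.1 * zmono x.2 z.

Lemma mul_trigE s f :
  ae_eq mu setT (cL2_fun (mul_trig s f)) (fun z => trig_eval s z * cL2_fun f z).
Proof.
rewrite /mul_trig /trig_eval; elim: s => [|x s IH].
  rewrite big_nil; move: (cL0_zeroE mu); apply: filterS => z h _.
  by rewrite big_nil mul0r [LHS](h I).
rewrite big_cons.
move: (cL2_funZD x.1 (mulz x.2 f) (\sum_(y <- s) y.1 *: mulz y.2 f)) (mulzE x.2 f) IH.
apply: filterS3 => z h1 h2 h3 _.
by rewrite (h1 I) (h2 I) (h3 I) big_cons mulrDl mulrA.
Qed.

Lemma mul_trig_linear_span (c : R[i]) s t :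
  c *: mul_trig s L2_one + mul_trig t L2_one =
  mul_trig ([seq (c * x.1, x.2) | x <- s] ++ t) L2_one.
Proof.
rewrite /mul_trig big_cat big_map scaler_sumr; congr (_ + _).
by apply: eq_bigr => x _; rewrite scalerA.
Qed.

Lemma trig_dense f :
  exists s_ : nat -> trigpoly, cvg_cL2 (fun m => mul_trig (s_ m) L2_one) f.
Proof.
have [|c _ _ [s ->] [t ->]|w [h [wS wh h_orth]]] :=
    @cL2_projection _ _ _ mu [set g | exists s, g = mul_trig s L2_one] f.
- by exists [::]; rewrite /mul_trig big_nil.
- by eexists; exact: mul_trig_linear_span.
have /choice[s_ sE] := wS.
exists s_; rewrite (_ : (fun m => _) = w); last by apply/funext => m; rewrite -sE.
suff /eqP : f - h = 0 by rewrite subr_eq0 => /eqP ->.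
apply: cdot_mulz_eq0 => k; apply: h_orth; exists [:: (1, k)].
by rewrite /mul_trig big_seq1 scale1r.
Qed.

Definition mulzH a u : H2 := exist (fun g : L2 => g \in inH2) _ (mulz_H2 a (valP u)).

Definition H2_one : H2 := exist (fun g : L2 => g \in inH2) _ (@L2_one_in_H2 R n).

Definition polyH p : H2 := \sum_(x <- p) x.1 *: mulzH x.2 H2_one.

Lemma val_polyH p : val (polyH p) = mul_trig (trig_of p) L2_one.
Proof.
rewrite /polyH /mul_trig big_map (raddf_sum val).
by apply: eq_bigr => x _; exact: (linearZ_LR val).
Qed.

(** The part of [u] that is orthogonal to the analytic polynomials has no
    Fourier coefficient of nonnegative exponent; it has no other one because it
    lies in [H^2]. *)
Lemma polyH_dense u :
  exists p_ : nat -> anapoly, cvg_cL2 (fun m => val (polyH (p_ m))) (val u).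
Proof.
have [|c _ _ [p ->] [q ->]|w [h [wS wh h_orth]]] :=
    @cL2_projection _ _ _ mu [set g | exists p, g = val (polyH p)] (val u).
- by exists [::]; rewrite val_polyH /mul_trig big_nil.
- exists ([seq (c * x.1, x.2) | x <- p] ++ q); rewrite !val_polyH mul_trig_linear_span.
  by rewrite /trig_of map_cat -!map_comp.
have /choice[p_ pE] := wS.
exists p_; rewrite (_ : (fun m => _) = w); last by apply/funext => m; rewrite -pE.
have hH : h \in inH2.
  by apply: in_H2_closed wh _ => m; rewrite pE; exact: valP.
suff /eqP : val u - h = 0 by rewrite subr_eq0 => /eqP ->.
have /in_H2_cdotP uhH : val u - h \in inH2 by rewrite rpredB // (valP u).
apply: cdot_mulz_eq0 => k.
have [k0|/existsNP[j /negP]] := pselect (forall j, 0 <= k j); last first.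
  by rewrite -ltNge => kj; apply: uhH; exists j.
apply: h_orth; exists [:: (1, fun i => absz (k i))].
rewrite val_polyH /mul_trig big_seq1 scale1r; congr (mulz _ L2_one).
by apply/funext => i; rewrite /intexp /= gez0_abs.
Qed.

Lemma mulz_sum m s f :
  mulz m (mul_trig s f) = \sum_(x <- s) x.1 *: mulz (m + x.2) f.
Proof.
rewrite /mul_trig linear_sum; apply: eq_bigr => x _.
by rewrite linearZ /= mulzD.
Qed.

(** A high power of [z_1 ... z_n] clears the negative exponents of [s]. *)
Lemma mul_trig_shift s : exists m0, forall m, (m0 <= m)%N ->
  exists p, forall f, mulz (intexp (fun=> m)) (mul_trig s f) = mul_trig (trig_of p) f.
Proof.
exists (\sum_(x <- s) \sum_i `|x.2 i|)%N => m m0m.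
exists [seq (x.1, fun i => absz (m%:Z + x.2 i)) | x <- s] => f.
rewrite mulz_sum /mul_trig /trig_of -map_comp big_map /=.
rewrite big_seq [RHS]big_seq; apply: eq_bigr => x xs.
congr (_ *: mulz _ f); apply/funext => i; rewrite /intexp /= gez0_abs //.
have : (`|x.2 i| <= m)%N.
  apply: leq_trans m0m; rewrite (big_rem x) //= (bigD1 i) //= -addnA.
  exact: leq_addr.
by move: (x.2 i) => y; lia.
Qed.

End trigonometric_polynomials.

(** * The symbol of an invariant operator *)

Section invariant_operator.
Context {R : realType} {n : nat}.
Local Notation mu := (@haar R n).
Local Notation L2 := (cL2 mu).
Local Notation H2 := (H2 R n).
Local Notation N := (@cL2_norm R _ _ mu).
Context (T : {linear H2 -> H2}) (C : R) (C_ge0 : 0 <= C).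
Context (T_bounded : forall u : H2, N (val (T u)) <= C * N (val u)).
Context (T_inv : forall j (u v : H2),
  cdot (val (T (Tz j u))) (val (Tz j v)) = cdot (val (T u)) (val v)).
Implicit Types (f g : L2) (a b : 'I_n -> nat) (u v : H2).

Lemma val_mulzH a u : val (mulzH a u) = mulz (intexp a) (val u).
Proof. by []. Qed.

Lemma T_inv_mulzH a u v :
  cdot (val (T (mulzH a u))) (val (mulzH a v)) = cdot (val (T u)) (val v).
Proof.
have [m] := ubnP (\sum_i a i)%N; elim: m a => // m IH a am.
have [/existsP[j aj]|/existsPn a0] := boolP [exists j, 0 < a j]%N; last first.
  have mulzH0 (w : H2) : mulzH a w = w.
    apply: val_H2_inj; rewrite val_mulzH (_ : intexp a = 0) ?mulz0 //.
    by apply/funext => i; rewrite /intexp; have := a0 i; rewrite lt0n negbK => /eqP ->.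
  by rewrite !mulzH0.
pose b i := (a i - (i == j))%N.
have mulzHE (w : H2) : mulzH a w = Tz j (mulzH b w).
  apply: val_H2_inj; rewrite val_Tz !val_mulzH mulzD; congr (mulz _ _); apply/funext => i.
  rewrite /intexp /b [RHS]/((i == j)%:Z + (a i - (i == j))%:Z).
  by case: eqVneq => [->|_] /=; lia.
rewrite !mulzHE T_inv IH // -ltnS; apply: leq_trans am.
rewrite ltnS (bigD1 j) //= [X in (_ < X)%N](bigD1 j) //=.
rewrite /b eqxx -addSn leq_add //; first by rewrite subn1 prednK.
by apply: leq_sum => i _; exact: leq_subr.
Qed.

(** If [T] is Toeplitz with symbol [phi], this is the projection of [phi] onto
    the closed span of the characters with exponents at least [- m]. *)
Definition phi_ m : L2 := mulz (- intexp (fun=> m)) (val (T (mulzH (fun=> m) H2_one))).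

(** By invariance the exponent [m] can be lowered to [a], so the coefficients of
    [phi_ m] do not depend on [m] once [m] is large. *)
Lemma cdot_phi_ a m v : (forall i, a i <= m)%N ->
  cdot (phi_ m) (mulz (- intexp a) (val v)) = cdot (val (T (mulzH a H2_one))) (val v).
Proof.
move=> am; pose b i := (m - a i)%N.
have bE : intexp (fun=> m) - intexp a = intexp b.
  by apply/funext => i; transitivity (m%:Z - (a i)%:Z) => //; rewrite subzn.
rewrite /phi_ cdot_mulz opprK mulzD bE -val_mulzH.
have -> : mulzH (fun=> m) H2_one = mulzH b (mulzH a H2_one) :> H2.
  by apply: val_H2_inj; rewrite !val_mulzH mulzD -bE subrK.
exact: T_inv_mulzH.
Qed.

Lemma cdot_phi_phi_ m l : (m <= l)%N -> cdot (phi_ l) (phi_ m) = cdot (phi_ m) (phi_ m).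
Proof. by move=> ml; rewrite {2}/phi_ cdot_phi_ // /phi_ cdot_mulz2. Qed.

Lemma norm_phi_ m : N (phi_ m) <= C * N L2_one.
Proof.
rewrite cL2_norm_mulz; apply: le_trans (T_bounded _) _.
by rewrite val_mulzH cL2_norm_mulz.
Qed.

Lemma sqr_norm_phi_B m l : (m <= l)%N ->
  (N (phi_ l - phi_ m)) ^+ 2 = (N (phi_ l)) ^+ 2 - (N (phi_ m)) ^+ 2.
Proof.
by move=> ml; rewrite sqr_cL2_normB cdot_phi_phi_ // -sqr_cL2_normE; ring.
Qed.

(** The squared norms increase and are bounded, and by orthogonality of the
    increments they control the distances. *)
Lemma phi_cvg : exists phi, cvg_cL2 phi_ phi.
Proof.
pose v m := (N (phi_ m)) ^+ 2.
have nd_v : nondecreasing_seq v.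
  by move=> m l ml; rewrite -subr_ge0 -sqr_norm_phi_B // sqr_ge0.
have ub_v : has_ubound (range v).
  exists ((C * N L2_one) ^+ 2) => _ [m _ <-].
  by rewrite lerXn2r ?norm_phi_ ?nnegrE ?mulr_ge0 ?cL2_norm_ge0.
have cv := nondecreasing_is_cvgn nd_v ub_v.
have v_le m : v m <= limn v := nondecreasing_cvgn_le nd_v cv m.
apply: cL2_complete => e e0.
have /cvgrPdist_le /(_ (e ^+ 2)) := cv; rewrite exprn_gt0 // => /(_ isT) [m _ mv].
have key k l : (m <= k)%N -> (k <= l)%N -> N (phi_ l - phi_ k) <= e.
  move=> mk kl; rewrite -(@ler_pXn2r _ 2) ?nnegrE ?cL2_norm_ge0 ?(ltW e0) //.
  rewrite sqr_norm_phi_B //; apply: le_trans (mv k mk).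
  by apply: le_trans (ler_norm _); rewrite lerD2r v_le.
exists m => k l mk ml; have [kl|/ltnW lk] := leqP k l; last exact: key.
by rewrite cL2_normBC key.
Qed.

Context (phi : L2) (phi_lim : cvg_cL2 phi_ phi).

Lemma cdot_phi a v :
  cdot phi (mulz (- intexp a) (val v)) = cdot (val (T (mulzH a H2_one))) (val v).
Proof.
apply: cdot_cvg_near phi_lim _; exists (\max_i a i)%N => // m /= am.
by apply: cdot_phi_ => i; apply: leq_trans am; exact: leq_bigmax.
Qed.

Lemma cdot_mul_trig_phi_analytic p v :
  cdot (mul_trig (trig_of p) phi) (val v) = cdot (val (T (polyH p))) (val v).
Proof.
rewrite /mul_trig big_map /polyH linear_sum (raddf_sum val) !cdot_suml.
apply: eq_bigr => x _ /=.
have -> : val (T (x.1 *: mulzH x.2 H2_one)) = x.1 *: val (T (mulzH x.2 H2_one)).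
  by rewrite linearZ.
by rewrite !cdotZl cdot_mulz cdot_phi.
Qed.

(** Multiplying [s] and [t] by a common high power of the coordinates leaves the
    inner product unchanged and makes both polynomials analytic, where
    multiplication by [phi] has the same form as [T]. *)
Lemma cdot_mul_trig_phi_le s t :
  normc (cdot (mul_trig s phi) (mul_trig t L2_one)) <=
  C * N (mul_trig s L2_one) * N (mul_trig t L2_one).
Proof.
have [ms sP] := mul_trig_shift s; have [mt tP] := mul_trig_shift t.
have [p pE] := sP _ (leq_maxl ms mt); have [q qE] := tP _ (leq_maxr ms mt).
rewrite -(cdot_mulz2 (intexp (fun=> maxn ms mt))) pE qE -val_polyH.
rewrite cdot_mul_trig_phi_analytic.
apply: le_trans (cauchy_schwarz _ _) _.
apply: ler_pM; rewrite ?cL2_norm_ge0 //.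
  by apply: le_trans (T_bounded _) _; rewrite val_polyH -pE cL2_norm_mulz.
by rewrite val_polyH -qE cL2_norm_mulz.
Qed.

Lemma cdot_mul_trig_phi_le_L2 s g :
  normc (cdot (mul_trig s phi) g) <= C * N (mul_trig s L2_one) * N g.
Proof.
have [t_ tg] := trig_dense g.
rewrite cdotC Defs.normcJ; apply: cdot_cvg_le tg _ => m.
by rewrite cdotC Defs.normcJ; exact: cdot_mul_trig_phi_le.
Qed.

(** Let [f] be the indicator of [A] and let [g] be the product of [phi] and [f].
    Multiplication by [phi] has norm at most [C] on trigonometric polynomials,
    so by density the norm of [g] is at most [C] times that of [f]; but
    [C < normc phi] on [A], which must therefore be null. The upper bound [K]
    keeps [normc phi ^+ 2] bounded on [A]. *)
Lemma phi_bound_on (K : R) (A := [set z | C < normc (cL2_fun phi z) <= K]) :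
  {ae mu, forall z, ~ A z}.
Proof.
have mphi := measurable_normc (measurable_cL2 phi).
have mA : measurable A.
  rewrite (_ : A = (fun z => normc (cL2_fun phi z)) @^-1` `]C, K]).
    by rewrite -[X in measurable X]setTI; exact: mphi.
  by apply/seteqP; split => z /=; rewrite in_itv.
pose h z : R[i] := (\1_A z)%:C.
have mh : measurable_fun setT h by apply: measurable_ofR; exact: measurable_indic.
have of_bounded (F : torus R n -> R[i]) (M : R) : measurable_fun setT F ->
    (forall z, normc (F z) <= M) -> exists f : L2, ae_eq mu setT (cL2_fun f) F.
  move=> mF FM; apply: cL2_of_sqr_integrable => //.
  apply: (@le_lt_trans _ _ (\int[mu]_z ((M ^+ 2)%:E))%E).
    apply: ge0_le_integral => //.
    - by move=> z _; rewrite lee_fin sqr_ge0.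
    - exact: measurable_sqr_normc.
    - move=> z _; rewrite lee_fin lerXn2r ?nnegrE ?normc_ge0 //.
      exact: le_trans (normc_ge0 _) (FM z).
  by rewrite probability_integral_cst ltry.
have hA z : h z = 0 \/ (h z = 1 /\ C < normc (cL2_fun phi z) <= K).
  rewrite /h indicE; have [zA|zA] := boolP (z \in A); [right|by left].
  by split => //; move: zA; rewrite inE.
have [f fE] : exists f : L2, ae_eq mu setT (cL2_fun f) h.
  apply: (of_bounded _ 1) => // z.
  by have [->|[-> _]] := hA z; rewrite ?Normc.normc0 ?Normc.normc1.
have [g gE] : exists g : L2, ae_eq mu setT (cL2_fun g) (fun z => h z * cL2_fun phi z).
  apply: (of_bounded _ `|K|) => [|z].
    by apply: measurable_cplxM => //; exact: measurable_cL2.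
  have [->|[-> /andP[_ zK]]] := hA z; first by rewrite mul0r Normc.normc0.
  by rewrite mul1r (le_trans zK) // ler_norm.
have [gg ggE] : exists gg : L2,
    ae_eq mu setT (cL2_fun gg) (fun z => h z * ((normc (cL2_fun phi z)) ^+ 2)%:C).
  apply: (of_bounded _ (`|K| ^+ 2)) => [|z].
    apply: measurable_cplxM => //; apply: measurable_ofR; exact: measurable_funX.
  have [->|[-> /andP[_ zK]]] := hA z; first by rewrite mul0r Normc.normc0 sqr_ge0.
  rewrite mul1r normc_real ?sqr_ge0 // lerXn2r ?nnegrE ?normc_ge0 //.
  by rewrite (le_trans zK) // ler_norm.
(* Moving [phi] from the left factor to the right one turns [g] into [gg]. *)
have cdot_g s : cdot (mul_trig s phi) g = cdot (mul_trig s L2_one) gg.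
  apply: cdot_ae; move: (mul_trigE s phi) gE.
  have : ae_eq mu setT (fun z => cL2_fun (mul_trig s L2_one) z * conjc (cL2_fun gg z))
      (fun z => trig_eval s z * conjc (h z * ((normc (cL2_fun phi z)) ^+ 2)%:C)).
    move: (mul_trigE s L2_one) (@L2_oneE R n) ggE; apply: filterS3 => z h1 h2 h3 _.
    by rewrite (h1 I) (h2 I) (h3 I) mulr1.
  apply: filterS3 => z h1 h2 h3 _; rewrite [RHS](h1 I) (h2 I) (h3 I) -mulcJ.
  have [->|[-> _]] := hA z; first by rewrite !mul0r conjc0 !mulr0.
  by rewrite !mul1r rmorphM /= conjcK -mulrA [conjc _ * _]mulrC.
have cdot_f : cdot f gg = cdot g g.
  apply: cdot_ae; move: fE gE ggE; apply: filterS3 => z h1 h2 h3 _.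
  rewrite (h1 I) (h2 I) (h3 I) -mulcJ.
  have [->|[-> _]] := hA z; first by rewrite !mul0r.
  by rewrite !mul1r rmorphM /= conjcK mulrC.
have gf : N g <= C * N f.
  have [->|g0] := eqVneq (N g) 0; first by rewrite mulr_ge0 ?cL2_norm_ge0.
  have ggt0 : 0 < N g by rewrite lt_neqAle eq_sym g0 cL2_norm_ge0.
  rewrite -(ler_pM2r ggt0) -expr2 -[leLHS]normc_real ?sqr_ge0 // -cdot_norm -cdot_f.
  have [s_ sf] := trig_dense f.
  rewrite mulrAC; apply: cdot_cvg_le sf _ => m; rewrite -cdot_g.
  by rewrite mulrAC; exact: cdot_mul_trig_phi_le_L2.
pose F z := (\1_A z : R) * ((normc (cL2_fun phi z)) ^+ 2 - C ^+ 2).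
have F0 z : 0 <= F z.
  rewrite /F indicE; have [|] := boolP (z \in A); last by rewrite mul0r.
  rewrite inE => /andP[Cz _]; rewrite mul1r subr_ge0.
  by rewrite lerXn2r ?nnegrE ?normc_ge0 // ltW.
have mF : measurable_fun setT F.
  apply: measurable_funM; first exact: measurable_indic.
  by apply: measurable_funB => //; exact: measurable_funX.
have intF : (\int[mu]_z (F z)%:E = 0)%E.
  apply/eqP; rewrite eq_le; apply/andP; split; last first.
    by apply: integral_ge0 => z _; rewrite lee_fin.
  rewrite -(@leeD2rE _ ((C ^+ 2 * (N f) ^+ 2)%:E)) // add0e.
  apply: (@le_trans _ _ ((N g) ^+ 2)%:E); last first.
    by rewrite lee_fin -exprMn lerXn2r ?nnegrE ?mulr_ge0 ?cL2_norm_ge0.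
  rewrite le_eqVlt; apply/orP; left; apply/eqP.
  rewrite EFinM -!integral_sqr_cL2 -ge0_integralZl //; last 3 first.
  - exact/measurable_sqr_normc/measurable_cL2.
  - by move=> z _; rewrite lee_fin sqr_ge0.
  - by rewrite lee_fin sqr_ge0.
  have mf2 : measurable_fun setT
      (fun z => (C ^+ 2)%:E * ((normc (cL2_fun f z)) ^+ 2)%:E)%E.
    by apply: emeasurable_funM => //; exact/measurable_sqr_normc/measurable_cL2.
  rewrite -ge0_integralD //; last 3 first.
  - by move=> z _; rewrite lee_fin.
  - exact/measurable_EFinP.
  - by move=> z _; rewrite mule_ge0 // lee_fin sqr_ge0.
  apply: ae_eq_integral => //.
  - by apply: emeasurable_funD => //; exact/measurable_EFinP.
  - exact/measurable_sqr_normc/measurable_cL2.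
  move: fE gE; apply: filterS2 => z h1 h2 _; rewrite (h1 I) (h2 I).
  rewrite -EFinM -EFinD; congr (_%:E); rewrite /F /h.
  have h0 : 0 <= (\1_A z : R) by rewrite indicE ler0n.
  rewrite Normc.normcM !normc_real // indicE.
  by case: (z \in A) => /=; ring.
have : ae_eq mu setT (EFin \o F) (cst 0%E).
  apply/ae_eq_integral_abs => //; first exact/measurable_EFinP.
  by under eq_integral do rewrite gee0_abs ?lee_fin //.
apply: filterS => z /(_ I) [] Fz zA; move: Fz.
have /andP[Cz _] := zA.
rewrite /F indicE mem_set // mul1r => /eqP; rewrite subr_eq0 => /eqP Fz.
by move: Cz; rewrite -(@ltr_pXn2r _ 2) ?nnegrE ?normc_ge0 // Fz ltxx.
Qed.

Lemma phi_bound : {ae mu, forall z, normc (cL2_fun phi z) <= C}.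
Proof.
have /ae_foralln : forall m : nat,
    {ae mu, forall z, ~ C < normc (cL2_fun phi z) <= m%:R}.
  by move=> m; exact: phi_bound_on.
apply: filterS => z zA; rewrite leNgt; apply/negP => Cz.
apply: (zA (Num.truncn (normc (cL2_fun phi z))).+1).
by rewrite Cz /= ltW // truncnS_gt.
Qed.

Definition symbol : cLoo mu := Loo_of phi_bound.

Lemma cmul_symbol_le f : N (cmul symbol f) <= C * N f.
Proof.
apply: cL2_norm_le_ae => //; move: (cmulE symbol f) phi_bound.
apply: filterS2 => z h1 h2; rewrite (h1 I) Normc.normcM.
by rewrite ler_wpM2r // normc_ge0.
Qed.

Lemma cmul_symbol_mul_trig s : cmul symbol (mul_trig s L2_one) = mul_trig s phi.
Proof.
apply/cL2P; have h1 := cmulE symbol (mul_trig s L2_one); have h2 := mul_trigE s L2_one.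
have h3 := @L2_oneE R n; have h4 := mul_trigE s phi.
move: h1 h2 h3 h4; apply: filterS4 => z h1 h2 h3 h4 _.
by rewrite (h1 I) (h2 I) (h3 I) (h4 I) mulr1 mulrC.
Qed.

(** Both sides are continuous in [u] and agree on analytic polynomials. *)
Lemma T_symbol u v : cdot (val (T u)) (val v) = cdot (cmul symbol (val u)) (val v).
Proof.
have [p_ pu] := polyH_dense u.
pose w_ m := val (T (polyH (p_ m))) - cmul symbol (val (polyH (p_ m))).
pose w := val (T u) - cmul symbol (val u).
have ww : cvg_cL2 w_ w.
  apply/cvg_cL2P => e e0.
  have C1 : 0 < 2 * C + 1 by rewrite ltr_wpDl // mulr_ge0.
  have /(cvg_cL2P _ _).1 /(_ (e / (2 * C + 1))) := pu; rewrite divr_gt0 // => /(_ isT).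
  apply: filterS => m um.
  have -> : w_ m - w =
      val (T (polyH (p_ m) - u)) - cmul symbol (val (polyH (p_ m)) - val u).
    have -> : val (T (polyH (p_ m) - u)) = val (T (polyH (p_ m))) - val (T u).
      by rewrite linearB.
    have -> : cmul symbol (val (polyH (p_ m)) - val u) =
        cmul symbol (val (polyH (p_ m))) - cmul symbol (val u).
      by rewrite addrC -scaleN1r cmul_linear scaleN1r addrC.
    rewrite /w_ /w !opprB [LHS]addrACA [RHS]addrACA; congr (_ + _).
    exact: addrC.
  apply: le_trans (cL2_normD _ _) _; rewrite cL2_normN.
  have h1 := T_bounded (polyH (p_ m) - u).
  have h2 := cmul_symbol_le (val (polyH (p_ m)) - val u).
  have valB : val (polyH (p_ m) - u) = val (polyH (p_ m)) - val u by [].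
  rewrite valB in h1.
  apply: le_trans (lerD h1 h2) _; rewrite -mulr2n -mulrnAl.
  rewrite -[leRHS](divfK (lt0r_neq0 C1)) mulrC ler_pM ?cL2_norm_ge0 ?mulrn_wge0 //.
  by rewrite mulr_natl lerDl.
have : cdot w (val v) = 0.
  apply: cdot_cvg_near ww _; apply: nearW => m.
  by rewrite /w_ cdotBl val_polyH cmul_symbol_mul_trig cdot_mul_trig_phi_analytic subrr.
by rewrite /w cdotBl => /eqP; rewrite subr_eq0 => /eqP.
Qed.

End invariant_operator.

(** * The characterization of Toeplitz operators *)

Theorem theorem3p1 (R : realType) (n : nat) (n_ge1 : (1 <= n)%N)
    (T : {linear H2 R n -> H2 R n}) (T_bounded : bounded_op T) :
  toeplitz T <-> forall j : 'I_n, adjoint (Tz j) \o T \o Tz j = T.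
Proof.
split=> [[phi TE] j|T_inv].
  apply/adjoint_Tz_invariantP => u v.
  apply: (@toeplitz_form_invariant _ _ phi) => {}u {}v.
  by rewrite TE; exact: cdot_projH2.
have {}T_inv j u v : cdot (val (T (Tz j u))) (val (Tz j v)) = cdot (val (T u)) (val v).
  exact: (adjoint_Tz_invariantP T j).1.
have [C T_le] := T_bounded.
have T_le' (u : H2 R n) : cL2_norm (val (T u)) <= Num.max C 0 * cL2_norm (val u).
  by apply: le_trans (T_le u) _; rewrite ler_wpM2r ?cL2_norm_ge0 // le_max lexx.
have C_ge0 : 0 <= Num.max C 0 by rewrite le_max lexx orbT.
have [phi phi_lim] := phi_cvg C_ge0 T_le' T_inv.
exists (symbol C_ge0 T_le' T_inv phi_lim); apply/funext => u; apply: cdot_H2_inj => v.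
apply: etrans (T_symbol C_ge0 T_le' T_inv phi_lim u v) _.
by symmetry; exact: cdot_projH2.
Qed.
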